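(* Fix $\eta\in(0,1)$. There is a constant $C$ depending only on $\eta$ such that the following holds. Consider the nonparametric Bradley--Terry model for $n$ teams with win probabilities $p_{ij}$. Let $M$ be the $n\times n$ matrix whose $(i,j)$th entry is $p_{ij}$ if $i\ne j$ and $0$ if $i=j$. Let $p\in(0,1]$ and suppose that for each pair $i\neq j$ the game between $i$ and $j$ takes place with probability $p$ and does not take place with probability $1-p$, independently of other games. Let $X$ be the data matrix whose $(i,j)$th entry is $1$ if team $i$ won over team $j$, $0$ if team $j$ won over team $i$, and recorded as missing if team $i$ did not play versus team $j$; if team $i$ has played against team $j$ multiple times, the $(i,j)$th entry of $X$ is the proportion of times that $i$ won over $j$ (draws are not allowed); all diagonal entries of $X$ are zero. Let $\hat M$ be the USVT estimate of $M$, with tuning parameter $\eta$, based on $X$. Then $$\operatorname{MSE}(\hat M)\le\frac{Cn^{-1/4}}{\sqrt p}.$$ In particular, the estimation problem is solvable whenever $p\gg n^{-1/2}$ (i.e. $\operatorname{MSE}(\hat M)\to0$ as $n\to\infty$ if $p=p_n$ satisfies $p_nn^{1/2}\to\infty$).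
   Context: Nonparametric Bradley--Terry model: there are $n$ teams; $p_{ij}\in[0,1]$ is the probability that team $i$ beats team $j$ in a match between them, with $p_{ji}=1-p_{ij}$ for $i\ne j$. The teams have a (unknown) total ordering by strength such that if team $i$ is stronger than team $j$, then $p_{ik}\ge p_{jk}$ for all $k\ne i,j$. Nothing else is assumed about the $p_{ij}$. The outcomes of all games are independent of each other and of which games take place. (When multiple games between $i$ and $j$ occur, their number is a fixed positive integer, and either all of them or none of them take place.) Observations: the pair $\{i,j\}$, $i\neq j$, is observed if and only if the game(s) between $i$ and $j$ take place, and then both $x_{ij}$ and $x_{ji}=1-x_{ij}$ are observed. Diagonal entries (all zero) are also regarded as observed with probability $p$ each, independently of everything else (this only affects $\hat p$ below). $\operatorname{MSE}(\hat M):=\mathbb{E}\big[\frac1{n^2}\sum_{i,j=1}^n(\hat m_{ij}-m_{ij})^2\big]$. USVT estimator with tuning parameter $\eta\in(0,1)$: let $y_{ij}=x_{ij}$ if $x_{ij}$ is observed and $y_{ij}=0$ otherwise, $Y=(y_{ij})$, with singular value decomposition $Y=\sum_{i=1}^n s_iu_iv_i^T$. Let $\hat p$ be the proportion of observed entries among those on and above the diagonal. Let $S:=\{i: s_i\ge(2+\eta)\sqrt{n\hat p}\}$ and $W:=\frac1{\hat p}\sum_{i\in S}s_iu_iv_i^T$ (if $\hat p=0$, put $W:=0$). Finally $\hat m_{ij}$ is the truncation of $w_{ij}$ to $[-1,1]$ ($\hat m_{ij}=w_{ij}$ if $|w_{ij}|\le1$, $1$ if $w_{ij}>1$, $-1$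 if $w_{ij}<-1$). *)

(* Defs.v *)
From HB Require Import structures.
From mathcomp Require Import all_boot all_order all_algebra finmap.
From mathcomp Require Import all_classical all_reals all_analysis.

Set Implicit Arguments.
Unset Strict Implicit.
Unset Printing Implicit Defensive.

Import Order.TTheory GRing.Theory Num.Theory.
Import numFieldNormedType.Exports.

Local Open Scope classical_set_scope.
Local Open Scope ring_scope.

(* The product rule for finite subfamilies of events is equivalent to
   independence of the indicator variables of the events. *)
Definition mutually_independent (R : realType) (d : measure_display)
    (T : measurableType d) (P : probability T R)
    (I : choiceType) (D : set I) (A : I -> set T) : Prop :=
  forall F : {fset I}, [set` F] `<=` D ->
    P (\bigcap_(i in [set` F]) A i) = (\prod_(i <- F) P (A i))%E.

(* The diagonal values of [q] are unconstrained and never used. *)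
Definition win_probabilities (R : realType) (n : nat)
    (q : 'I_n -> 'I_n -> R) : Prop :=
  forall i j, i != j -> 0 <= q i j <= 1 /\ q j i = 1 - q i j.

Definition strict_total_order (T : eqType) (r : rel T) : Prop :=
  [/\ irreflexive r, transitive r & forall x y, x != y -> r x y || r y x].

Definition nonparametric_bradley_terry (R : realType) (n : nat)
    (q : 'I_n -> 'I_n -> R) : Prop :=
  win_probabilities q /\
  exists2 stronger : rel 'I_n, strict_total_order stronger &
    forall i j k, stronger i j -> k != i -> k != j -> q j k <= q i k.

(* Indices of the independent sources of randomness: [inl (i, j)] is the event
   that entry (i, j) is observed, [inr (i, j, k)] the event that i beats j in
   their k-th game. *)
Definition source (n : nat) : choiceType :=
  ('I_n * 'I_n + 'I_n * 'I_n * nat)%type.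

(* One representative per unordered pair; the diagonal is included among the
   observation events but not among the games. *)
Definition base_sources (n : nat) (ngames : 'I_n -> 'I_n -> nat) :
    set (source n) :=
  [set e : source n | match e with
                       | inl (i, j) => (i <= j)%N
                       | inr (i, j, k) => (i < j)%N && (k < ngames i j)%N
                       end].

Definition source_event (n : nat) (T : Type)
    (observed : 'I_n -> 'I_n -> set T) (won : 'I_n -> 'I_n -> nat -> set T)
    (e : source n) : set T :=
  match e with
  | inl (i, j) => observed i j
  | inr (i, j, k) => won i j k
  end.

(* For i != j, [observed i j] is the event that the game(s) between i and j
   take place; [observed i i] is the event that the i-th diagonal entry counts
   as observed.  The outcomes [won i j k], k < ngames i j, are defined whether
   or not the games take place. *)
Record tournament (R : realType) (n : nat) (q : 'I_n -> 'I_n -> R) (p : R) :=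
  Tournament {
    sample_display : measure_display;
    sample_space : measurableType sample_display;
    sample_prob : probability sample_space R;
    ngames : 'I_n -> 'I_n -> nat;
    observed : 'I_n -> 'I_n -> set sample_space;
    won : 'I_n -> 'I_n -> nat -> set sample_space;
    ngames_sym : forall i j, ngames i j = ngames j i;
    ngames_gt0 : forall i j, i != j -> (0 < ngames i j)%N;
    observed_sym : forall i j, observed i j = observed j i;
    no_draw : forall i j k, i != j -> (k < ngames i j)%N ->
      won j i k = ~` won i j k;
    measurable_observed : forall i j, measurable (observed i j);
    measurable_won : forall i j k, i != j -> (k < ngames i j)%N ->
      measurable (won i j k);
    prob_observed : forall i j, sample_prob (observed i j) = p%:E;
    prob_won : forall i j k, i != j -> (k < ngames i j)%N ->
      sample_prob (won i j k) = (q i j)%:E;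
    independent_sources :
      mutually_independent sample_prob (base_sources ngames)
        (source_event observed won)
  }.
Arguments observed {R n q p} t.
Arguments won {R n q p} t.

Definition win_proportion (R : realType) (n : nat) (q : 'I_n -> 'I_n -> R)
    (p : R) (E : tournament q p) (i j : 'I_n) (w : sample_space E) : R :=
  (\sum_(k < ngames E i j) \1_(won E i j k) w) / (ngames E i j)%:R.

(* [None] encodes a missing entry. *)
Definition data_matrix (R : realType) (n : nat) (q : 'I_n -> 'I_n -> R)
    (p : R) (E : tournament q p) (w : sample_space E) : 'M[option R]_n :=
  \matrix_(i, j)
    if w \in observed E i j then
      Some (if i == j then 0 else win_proportion i j w)
    else None.

Definition mean_matrix (R : realType) (n : nat) (q : 'I_n -> 'I_n -> R) :
    'M[R]_n :=
  \matrix_(i, j) if i == j then 0 else q i j.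

Definition is_svd (R : realType) (n : nat) (Y : 'M[R]_n)
    (s : 'I_n -> R) (U V : 'M[R]_n) : Prop :=
  [/\ U^T *m U = 1%:M, V^T *m V = 1%:M, forall i, 0 <= s i &
      Y = \sum_i s i *: (col i U *m (col i V)^T)].

Definition zero_filled (R : realType) (n : nat) (X : 'M[option R]_n) :
    'M[R]_n :=
  \matrix_(i, j) odflt 0 (X i j).

Definition phat (R : realType) (n : nat) (X : 'M[option R]_n) : R :=
  #|[set ij : 'I_n * 'I_n | (ij.1 <= ij.2)%N && isSome (X ij.1 ij.2)]%SET|%:R
  / #|[set ij : 'I_n * 'I_n | (ij.1 <= ij.2)%N]%SET|%:R.

Definition truncate (R : realType) (x : R) : R :=
  if 1 < x then 1 else if x < -1 then -1 else x.

(* When [phat X = 0], the convention [0^-1 = 0] yields the zero matrix. *)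
Definition thresholded (R : realType) (n : nat) (eta : R) (X : 'M[option R]_n)
    (s : 'I_n -> R) (U V : 'M[R]_n) : 'M[R]_n :=
  (phat X)^-1 *: \sum_(i | (2 + eta) * Num.sqrt (n%:R * phat X) <= s i)
                    s i *: (col i U *m (col i V)^T).

(* The thresholded matrix does not depend on the chosen singular value
   decomposition, so this relation is functional in [X]. *)
Definition is_usvt (R : realType) (n : nat) (eta : R) (X : 'M[option R]_n)
    (Mhat : 'M[R]_n) : Prop :=
  exists s U V, is_svd (zero_filled X) s U V /\
    Mhat = map_mx (@truncate R) (thresholded eta X s U V).

Definition MSE (R : realType) (d : measure_display) (T : measurableType d)
    (P : probability T R) (n : nat) (Mhat : T -> 'M[R]_n) (M : 'M[R]_n) :
    \bar R :=
  ('E_P[fun w =>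
     ((n%:R ^+ 2)^-1 * \sum_i \sum_j (Mhat w i j - M i j) ^+ 2)%R])%E.

(* Main.v *)
(* Write the zero-filled data as Y = p M + Z, where Z is centred and its entries
   are independent across unordered pairs of teams.

   Noise.  E tr (Z Z^T)^k is a sum over walks, explored one step at a time.
   After normalising Z by (n p)^(-1/2) =: b, the expectation attached to a walk
   is at most the product of step weights: 1/n for a step to a new vertex, 1
   for the second traversal of an edge that discovered a vertex, and b for
   every other step.  There may be several edges to retrace, but each such
   ambiguity lowers a potential which only steps of weight b can raise.  Hence
   a step costs at most 2 + b (2k+1)^2 in total and
   E tr (Z Z^T)^k <= n (2 + b (2k+1)^2)^(2k); no trees are counted.  With k of
   order n^(1/8), |Z| <= (2 + eta/2) (n p)^(1/2) up to probability n^(-1/4).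

   Signal.  Averaging the rows of M over groups of about n^(3/4) teams of
   consecutive strength is multiplication by a matrix Q with |Q|_F^2 of order
   n^(1/4), and by monotonicity |M - Q M|_F^2 is of order n^(7/4).  On the good
   event this controls the error of singular value thresholding.

   For p < n^(-1/2) the bound is trivial since the loss is at most 4. *)

(* The threshold leaves no slack in the leading constant: singular values are kept from (2 + eta) (n
   phat)^(1/2) on, so the noise has to stay below (2 + eta/2) (n p)^(1/2), and an unspecified
   multiple of (n p)^(1/2) would not do. Hence a step of a walk may cost only 2 plus a small term.
   That term is b (2k+1)^2, and b <= n^(-1/4) once p >= n^(-1/2); with k of order n^(1/8) it is at
   most eta/4, and the ratio of 2 + eta/4 to 2 + eta/2, raised to the power 2k, beats every power of
   n.

   Thresholding needs two estimates: how many singular values are kept, and how much of p M is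
   discarded. Both come from pairing p M with a matrix of known operator norm after inserting Q;
   only |Q|_F enters, so Q does the work of a rank or nuclear norm bound on M.

   The data depend on finitely many events, so expectations become finite sums with product weights.
   The loss is dominated configuration by configuration: the squared error of phat and the trace of
   a power of Z Z^T enter as penalties that exceed the trivial bound 4 whenever the good event
   fails. *)
Require Import Defs.
From HB Require Import structures.
From mathcomp Require Import all_boot all_order all_algebra finmap.
From mathcomp Require Import all_classical all_reals all_analysis.
From mathcomp Require Import measurable_realfun zify ring lra.
Import Order.TTheory GRing.Theory Num.Theory.
Import numFieldNormedType.Exports.
Local Open Scope ring_scope.

Set Implicit Arguments.
Unset Strict Implicit.
Unset Printing Implicit Defensive.

(** * Exploring walks *)

Section OpenGraph.
Variable I : finType.
Implicit Types (H : rel I) (x y : I).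

Definition edge_degree H x : nat := #|[pred y | H x y]|.

(* Potential of an exploration at [x] with edges [H] left to retrace.  The
   subtraction is truncated. *)
Definition excess H x : nat :=
  (\sum_w (edge_degree H w - (if w == x then 1 else 2)))%N.

Lemma eq_edge_degree H H' x : H x =1 H' x -> edge_degree H x = edge_degree H' x.
Proof. by move=> eqH; apply: eq_card => y; rewrite !inE eqH. Qed.

Lemma eq_excess H H' x : H =2 H' -> excess H x = excess H' x.
Proof. by move=> eqH; apply: eq_bigr => w _; rewrite (@eq_edge_degree H H'). Qed.

(** Only [y] sees its allowance shrink, from 2 to 1; that of [x] can only grow. *)
Lemma excess_move H x y : (excess H y <= (excess H x).+1)%N.
Proof.
rewrite /excess (bigD1 y) //= [X in (_ <= X.+1)%N](bigD1 y) //= eqxx.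
set s1 := (\sum_(i | i != y) _)%N; set s2 := (\sum_(i | i != y) _)%N.
have : (s1 <= s2)%N.
  apply: leq_sum => w /negPf ->; case: (w == x) => //; exact: leq_sub2l.
by case: (y == x); lia.
Qed.

Lemma excess_split H H' x y : x != y ->
  (forall w, w != x -> w != y -> edge_degree H w = edge_degree H' w) ->
  exists s, excess H x = (edge_degree H x - 1 + (edge_degree H y - 2) + s)%N /\
            excess H' y = (edge_degree H' x - 2 + (edge_degree H' y - 1) + s)%N.
Proof.
move=> xy eqd; exists (\sum_(w | (w != x) && (w != y)) (edge_degree H w - 2))%N.
rewrite /excess; split.
  rewrite (bigD1 x) //= (bigD1 y) /=; last by rewrite eq_sym.
  rewrite eqxx (eq_sym y) (negPf xy) -addnA; congr (_ + (_ + _))%N.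
  by apply: eq_bigr => w /andP[/negPf -> _].
rewrite (bigD1 x) //= (bigD1 y) /=; last by rewrite eq_sym.
rewrite eqxx (negPf xy) -addnA; congr (_ + (_ + _))%N.
by apply: eq_bigr => w /andP[wx wy]; rewrite (negPf wy) eqd.
Qed.

Definition same_edge x y u v := ((u == x) && (v == y)) || ((u == y) && (v == x)).

(** When a walk follows a tree, the edges left to retrace form a path ending at the current vertex:
    degree 1 there, at most 2 elsewhere. These are the allowances in [excess]. A fresh [y] has
    degree 1 and allowance 1, while [x] gains one edge and one unit of allowance, so nothing
    changes. *)
Lemma excess_open H x y : x != y -> (forall u, H y u = false) ->
  (forall u, H u y = false) ->
  excess (fun u v => H u v || same_edge x y u v) y = excess H x.
Proof.
move=> xy Hy yH; set H' := fun u v => _.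
have [|s [-> ->]] := @excess_split H H' x y xy.
  move=> w wx wy; apply: eq_edge_degree => u.
  by rewrite /H' /same_edge (negPf wx) (negPf wy) orbF.
have -> : edge_degree H y = 0%N by apply: eq_card0 => u; rewrite !inE Hy.
have -> : edge_degree H' y = 1%N.
  rewrite -(card1 x); apply: eq_card => u.
  by rewrite !inE /H' /same_edge Hy eqxx eq_sym (negPf xy).
have -> : edge_degree H' x = (edge_degree H x).+1.
  rewrite /edge_degree (cardD1 y) inE /H' /same_edge !eqxx orbT add1n; congr _.+1.
  apply: eq_card => u; rewrite !inE (negPf xy) /= orbF.
  by case: eqP => [->|] //=; rewrite ?yH ?orbF.
lia.
Qed.

(** At [y] the lost edge offsets the smaller allowance. At [x] the degree drops and the allowance
    rises, so the truncated term falls by at least 1 as soon as there was a choice between several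
    edges. *)
Lemma excess_close H x y : x != y -> symmetric H -> H x y ->
  (excess (fun u v => H u v && ~~ same_edge x y u v) y
     + (1 < edge_degree H x) <= excess H x)%N.
Proof.
move=> xy symH Hxy; set H' := fun u v => _.
have [|s [-> ->]] := @excess_split H H' x y xy.
  move=> w wx wy; apply: eq_edge_degree => u.
  by rewrite /H' /same_edge (negPf wx) (negPf wy) andbT.
have -> : edge_degree H x = (edge_degree H' x).+1.
  rewrite /edge_degree (cardD1 y) inE Hxy add1n; congr _.+1; apply: eq_card => u.
  by rewrite !inE /H' /same_edge eqxx (negPf xy) orbF /= andbC.
have -> : edge_degree H y = (edge_degree H' y).+1.
  rewrite /edge_degree (cardD1 x) inE symH Hxy add1n; congr _.+1; apply: eq_card => u.
  by rewrite !inE /H' /same_edge eqxx (eq_sym y) (negPf xy) /= andbC.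
lia.
Qed.

Lemma excess0 x : excess (fun _ _ => false) x = 0%N.
Proof.
rewrite /excess big1 // => w _; rewrite (_ : edge_degree _ w = 0%N) ?sub0n //.
by apply: eq_card0.
Qed.

End OpenGraph.

(** * Expectations under finite product measures *)

Section ProductExpectation.
Variables (R : realFieldType) (P J : finType) (mu : P -> J -> R).

(** Used at two levels: over all pairs of teams, where [J] is the outcome of a whole block, and
    inside one block, over its observation and its games. *)
Definition expect (F : {ffun P -> J} -> R) : R :=
  \sum_c F c * \prod_e mu e (c e).

Hypothesis mu_sum1 : forall e, \sum_d mu e d = 1.

Lemma expect_prod (g : P -> J -> R) :
  expect (fun c => \prod_e g e (c e)) = \prod_e \sum_d g e d * mu e d.
Proof.
rewrite bigA_distr_bigA /expect.
by apply: eq_bigr => c _; rewrite -big_split.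
Qed.

Lemma eq_expect F G : F =1 G -> expect F = expect G.
Proof. by move=> eqFG; apply: eq_bigr => c _; rewrite eqFG. Qed.

Lemma expectD F G : expect (fun c => F c + G c) = expect F + expect G.
Proof.
by rewrite /expect -big_split /=; apply: eq_bigr => c _; rewrite mulrDl.
Qed.

Lemma expectZ a F : expect (fun c => a * F c) = a * expect F.
Proof.
by rewrite /expect mulr_sumr; apply: eq_bigr => c _; rewrite mulrA.
Qed.

Lemma expect_sum (K : finType) (Q : pred K) F :
  expect (fun c => \sum_(k | Q k) F k c) = \sum_(k | Q k) expect (F k).
Proof.
rewrite exchange_big /=; apply: eq_bigr => c _.
by rewrite mulr_suml.
Qed.

Lemma expect_cst a : expect (fun=> a) = a.
Proof.
have E1 : expect (fun=> 1) = 1.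
  rewrite (@eq_expect _ (fun c => \prod_(e : P) 1)); last first.
    by move=> c; rewrite big1.
  rewrite (expect_prod (fun _ _ => 1)) big1 // => e _.
  by under eq_bigr do rewrite mul1r.
rewrite -[RHS]mulr1 -E1 -expectZ; apply: eq_expect => c.
by rewrite mulr1.
Qed.

Lemma expect_block (e : P) (f : J -> R) :
  expect (fun c => f (c e)) = \sum_d f d * mu e d.
Proof.
have := expect_prod (fun x d => if x == e then f d else 1).
rewrite (@eq_expect _ (fun c => f (c e))) => [->|c]; last first.
  by rewrite (bigD1 e) //= eqxx big1 ?mulr1 // => x /negPf ->.
rewrite (bigD1 e) //= [X in _ * X]big1 ?mulr1; first by rewrite eqxx.
move=> x /negPf ->; rewrite -[RHS](mu_sum1 x).
by apply: eq_bigr => d _; rewrite mul1r.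
Qed.

Lemma expect_indep (e1 e2 : P) (f g : J -> R) : e1 != e2 ->
  expect (fun c => f (c e1) * g (c e2)) =
  expect (fun c => f (c e1)) * expect (fun c => g (c e2)).
Proof.
move=> e12; rewrite !expect_block.
have := expect_prod
  (fun x d => if x == e1 then f d else if x == e2 then g d else 1).
rewrite (@eq_expect _ (fun c => f (c e1) * g (c e2))) => [->|c]; last first.
  rewrite (bigD1 e1) //= (bigD1 e2) /=; last by rewrite eq_sym.
  rewrite !eqxx (eq_sym e2) (negPf e12) big1 ?mulr1 //.
  by move=> x /andP[/negPf -> /negPf ->].
rewrite (bigD1 e1) //= (bigD1 e2) /=; last by rewrite eq_sym.
rewrite !eqxx (eq_sym e2) (negPf e12) [X in _ * (_ * X)]big1 ?mulr1 //.
move=> x /andP[/negPf -> /negPf ->]; rewrite -[RHS](mu_sum1 x).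
by apply: eq_bigr => d _; rewrite mul1r.
Qed.

End ProductExpectation.

(** * Moments of a centred random matrix with independent unordered pairs *)

Section WalkExpectation.
Variables (R : realFieldType) (n : nat) (J : finType).
Variable mu : 'I_n * 'I_n -> J -> R.
Hypothesis mu_ge0 : forall e d, 0 <= mu e d.
Hypothesis mu_sum1 : forall e, \sum_d mu e d = 1.

Definition upair (x y : 'I_n) : 'I_n * 'I_n := if (x <= y)%N then (x, y) else (y, x).

Lemma upairC x y : upair x y = upair y x.
Proof.
rewrite /upair; case: ltngtP => // /ord_inj -> //.
Qed.

Lemma upair_eq x y u v : (upair u v == upair x y) = same_edge x y u v.
Proof.
rewrite /same_edge; apply/eqP/idP; last first.
  by case/orP => /andP[/eqP -> /eqP ->] //; rewrite upairC.
rewrite /upair; case: ifP => _; case: ifP => _ [-> ->];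
  by rewrite ?eqxx ?orbT.
Qed.

Variable z : 'I_n -> 'I_n -> J -> R.
Variables (b v : R).
Hypothesis b_ge0 : 0 <= b.
Hypothesis v_ge0 : 0 <= v.
Hypothesis z_bound : forall x y d, `|z x y d| <= b.
Hypothesis z_mean : forall x y, \sum_d z x y d * mu (upair x y) d = 0.
Hypothesis z_var : forall x y, \sum_d z x y d ^+ 2 * mu (upair x y) d <= v.

(** Both orientations of a pair read the same coordinate of [c], so entries are dependent only
    within an unordered pair. *)
Definition noise (c : {ffun 'I_n * 'I_n -> J}) x y : R := z x y (c (upair x y)).

Definition multiplicity (h : seq ('I_n * 'I_n)) e : nat :=
  count (fun a => upair a.1 a.2 == e) h.

Arguments multiplicity : simpl never.

(* [T] collects the pairs whose first traversal discovered a new vertex. *)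
Definition history_wt (h : seq ('I_n * 'I_n)) (T : {set 'I_n * 'I_n}) : R :=
  \prod_e (if e \in T then v * b ^+ (multiplicity h e - 2) else b ^+ multiplicity h e).

Lemma history_wt_ge0 h T : 0 <= history_wt h T.
Proof.
by apply: prodr_ge0 => e _; case: ifP => _; rewrite ?mulr_ge0 ?exprn_ge0.
Qed.

Lemma prod_z_bound (s : seq ('I_n * 'I_n)) d :
  `|\prod_(a <- s) z a.1 a.2 d| <= b ^+ size s.
Proof.
elim: s => [|a s IH]; first by rewrite big_nil normr1 expr0.
by rewrite big_cons normrM exprS ler_pM.
Qed.

Lemma block_bound e (s : seq ('I_n * 'I_n)) :
  `|\sum_d (\prod_(a <- s) z a.1 a.2 d) * mu e d| <= b ^+ size s.
Proof.
rewrite -[leRHS]mulr1 -[X in _ * X](mu_sum1 e) mulr_sumr.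
apply: le_trans (ler_norm_sum _ _ _) _; apply: ler_sum => d _.
by rewrite normrM (ger0_norm (mu_ge0 e d)) ler_wpM2r ?prod_z_bound.
Qed.

(** A single factor has mean zero. Otherwise the first two factors, possibly of opposite
    orientation, are replaced by half the sum of their squares, of mean at most [v], and the others
    are bounded by [b]. *)
Lemma block_bound_tree e (s : seq ('I_n * 'I_n)) :
  all (fun a => upair a.1 a.2 == e) s -> (0 < size s)%N ->
  `|\sum_d (\prod_(a <- s) z a.1 a.2 d) * mu e d| <= v * b ^+ (size s - 2).
Proof.
case: s => [|a [|a' s]] //=.
  move=> /andP[/eqP <- _] _.
  under eq_bigr do rewrite big_cons big_nil mulr1.
  by rewrite z_mean normr0 mulr_ge0 ?exprn_ge0.
move=> /and3P[/eqP ae /eqP a'e _] _.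
have -> : ((size s).+2 - 2 = size s)%N by lia.
have var2 : \sum_d `|z a.1 a.2 d * z a'.1 a'.2 d| * mu e d <= v.
  apply: (@le_trans _ _ (\sum_d (z a.1 a.2 d ^+ 2 / 2 * mu e d
                                 + z a'.1 a'.2 d ^+ 2 / 2 * mu e d))).
    apply: ler_sum => d _; rewrite -mulrDl ler_wpM2r // normrM.
    have := sqr_ge0 (`|z a.1 a.2 d| - `|z a'.1 a'.2 d|).
    rewrite sqrrB !real_normK ?num_real //.
    set A := `|_| ; set B := `|_|; set A2 := _ ^+ 2; set B2 := _ ^+ 2.
    by clearbody A B A2 B2 => ?; lra.
  have := z_var a.1 a.2; have := z_var a'.1 a'.2; rewrite ae a'e big_split /=.
  under [X in _ -> _ -> X + _ <= _]eq_bigr do rewrite mulrAC.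
  under [X in _ -> _ -> _ + X <= _]eq_bigr do rewrite mulrAC.
  rewrite -!mulr_suml; lra.
apply: le_trans (ler_norm_sum _ _ _) _.
apply: le_trans (ler_wpM2r (exprn_ge0 _ b_ge0) var2).
rewrite mulr_suml; apply: ler_sum => d _.
rewrite !big_cons mulrA !normrM (ger0_norm (mu_ge0 e d)) -!mulrA.
rewrite !ler_wpM2l // mulrC ler_wpM2l // prod_z_bound //.
Qed.

(** Grouping the factors by unordered pair splits the expectation into independent blocks, one for
    each factor of [history_wt]. *)
Lemma history_bound h (T : {set _}) : (forall e, e \in T -> (0 < multiplicity h e)%N) ->
  `|expect mu (fun c => \prod_(a <- h) noise c a.1 a.2)| <= history_wt h T.
Proof.
move=> T_used.
pose s e := [seq a <- h | upair a.1 a.2 == e].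
have size_s e : size (s e) = multiplicity h e by rewrite size_filter.
rewrite (@eq_expect _ _ _ mu _
  (fun c => \prod_e \prod_(a <- s e) z a.1 a.2 (c e))); last first.
  move=> c; under [RHS]eq_bigr => e _ do rewrite big_filter.
  rewrite [RHS](exchange_big_dep xpredT) //=; apply: eq_bigr => a _.
  by rewrite (big_pred1 (upair a.1 a.2)) // => e; rewrite eq_sym.
rewrite (expect_prod mu (fun e d => \prod_(a <- s e) z a.1 a.2 d)).
rewrite normr_prod /history_wt; apply: ler_prod => e _; rewrite normr_ge0 /=.
case: ifP => [eT|_]; last by rewrite -size_s block_bound.
rewrite -size_s block_bound_tree ?filter_all //.
by rewrite size_s T_used.
Qed.

(* Entry [(x, t)] of the alternating product Z Z^T Z ... with [m] factors, or of
   Z^T Z Z^T ... when [par] holds. *)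
Fixpoint alt_power (m : nat) (par : bool) (x t : 'I_n) c : R :=
  if m is m'.+1 then
    \sum_y noise c (if par then y else x) (if par then x else y)
            * alt_power m' (~~ par) y t c
  else (x == t)%:R.

(** This relation is the graph [H] to which [excess] is applied along a walk. *)
Definition unmatched h (T : {set 'I_n * 'I_n}) x y :=
  (upair x y \in T) && (multiplicity h (upair x y) == 1%N).

(** By symmetry of [upair], [visited_mult] covers both endpoints: no traversed pair touches a vertex
    outside [V]. *)
Record walk_state h (T : {set 'I_n * 'I_n}) (V : {set 'I_n}) x : Prop :=
  WalkState {
    tree_used : forall e, e \in T -> (0 < multiplicity h e)%N;
    tree_irr : forall u w, upair u w \in T -> u != w;
    visited_cur : x \in V;
    visited_mult : forall u w, (0 < multiplicity h (upair u w))%N -> u \in V }.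

Lemma unmatched_sym h T : symmetric (unmatched h T).
Proof. by move=> x y; rewrite /unmatched upairC. Qed.

Lemma multiplicity_cons h a e :
  multiplicity (a :: h) e = ((upair a.1 a.2 == e) + multiplicity h e)%N.
Proof. by []. Qed.

Section Step.
Variables (h : seq ('I_n * 'I_n)) (T : {set 'I_n * 'I_n}) (V : {set 'I_n}).
Variables (x y : 'I_n) (a : 'I_n * 'I_n).
Hypothesis st : walk_state h T V x.
Hypothesis a_xy : upair a.1 a.2 = upair x y.

(** Only the factor of the traversed pair changes, so each kind of step is described by one ratio
    [r]. *)
Lemma wt_step (T' : {set 'I_n * 'I_n}) r :
  T :\ upair x y = T' :\ upair x y ->
  (if upair x y \in T' then v * b ^+ ((multiplicity h (upair x y)).+1 - 2)
   else b ^+ (multiplicity h (upair x y)).+1) =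
  r * (if upair x y \in T then v * b ^+ (multiplicity h (upair x y) - 2)
   else b ^+ multiplicity h (upair x y)) ->
  history_wt (a :: h) T' = r * history_wt h T.
Proof.
move=> /setP eqT eqr; rewrite /history_wt (bigD1 (upair x y)) //=.
rewrite [in RHS](bigD1 (upair x y)) //= mulrA -eqr multiplicity_cons a_xy eqxx add1n.
congr (_ * _); apply: eq_bigr => e ne.
by have := eqT e; rewrite !inE ne /= multiplicity_cons a_xy eq_sym (negPf ne) => ->.
Qed.

Lemma mult_a u w : multiplicity (a :: h) (upair u w) =
  (same_edge x y u w + multiplicity h (upair u w))%N.
Proof. by rewrite multiplicity_cons a_xy eq_sym upair_eq. Qed.

Lemma stay_state : y \in V -> walk_state (a :: h) T V y.
Proof.
case: st => Tu Ti Vx Vm Vy; split=> // [e /Tu|u w].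
  by rewrite multiplicity_cons; lia.
rewrite mult_a; case: (boolP (same_edge x y u w)) => [|_]; last exact: Vm.
by rewrite /same_edge => /orP[] /andP[/eqP -> _].
Qed.

Lemma new_unused u : y \notin V -> multiplicity h (upair u y) = 0%N.
Proof.
move=> yV; apply/eqP; rewrite -leqn0 leqNgt; apply: contra yV.
by rewrite upairC; apply: visited_mult st _ _.
Qed.

Lemma new_notin_tree u : y \notin V -> upair u y \notin T.
Proof.
move=> yV; apply: contraTN isT => /(tree_used st).
by rewrite new_unused.
Qed.

Lemma new_state : y \notin V ->
  walk_state (a :: h) (upair x y |: T) (y |: V) y.
Proof.
move=> yV; have xy : x != y by apply: contraNneq yV => <-; apply: visited_cur st.
case: st => Tu Ti Vx Vm; split=> [e|u w||u w].
- rewrite multiplicity_cons in_setU1 a_xy eq_sym.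
  by case: eqP => //= _ /Tu; lia.
- rewrite in_setU1 => /orP[|/Ti //]; rewrite upair_eq /same_edge.
  by case/orP => /andP[/eqP -> /eqP ->] //; rewrite eq_sym.
- by rewrite !inE eqxx.
rewrite mult_a; case: (boolP (same_edge x y u w)) => [|_ /Vm]; last first.
  by rewrite !inE => ->; rewrite orbT.
by rewrite /same_edge !inE => /orP[] /andP[/eqP -> _]; rewrite ?eqxx ?Vx ?orbT.
Qed.

(** Discovery prepays the second traversal: at multiplicity 1 the truncated exponent 1 - 2 is
    already 0, so the full [v] is charged now and [close_wt] costs nothing. *)
Lemma new_wt : y \notin V -> history_wt (a :: h) (upair x y |: T) = v * history_wt h T.
Proof.
move=> yV; apply: wt_step.
  by apply/setP => e; rewrite !inE; case: eqP.
by rewrite setU11 (negPf (new_notin_tree x yV)) new_unused.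
Qed.

Lemma new_excess : y \notin V ->
  excess (unmatched (a :: h) (upair x y |: T)) y = excess (unmatched h T) x.
Proof.
move=> yV; have xy : x != y by apply: contraNneq yV => <-; apply: visited_cur st.
have ony u : unmatched h T u y = false.
  by rewrite /unmatched (negPf (new_notin_tree u yV)).
rewrite -(@excess_open _ (unmatched h T) x y) // => [|u]; last by rewrite unmatched_sym.
apply: eq_excess => u w; rewrite /unmatched in_setU1 upair_eq mult_a.
case: (boolP (same_edge x y u w)) => [|_]; last by rewrite orbF.
rewrite orbT /same_edge => /orP[] /andP[/eqP -> /eqP ->].
  by rewrite new_unused.
by rewrite upairC new_unused.
Qed.

Lemma close_wt : unmatched h T x y -> history_wt (a :: h) T = history_wt h T.
Proof.
move=> /andP[xyT /eqP m1]; rewrite (@wt_step T 1) ?mul1r //.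
by rewrite xyT m1.
Qed.

Lemma close_excess : unmatched h T x y ->
  (excess (unmatched (a :: h) T) y + (1 < edge_degree (unmatched h T) x)
     <= excess (unmatched h T) x)%N.
Proof.
move=> oxy; have xy : x != y by case/andP: oxy => /(tree_irr st).
apply: leq_trans (excess_close xy (@unmatched_sym h T) oxy).
rewrite leq_add2r eq_leq //; apply: eq_excess => u w.
rewrite /unmatched mult_a; case: (boolP (same_edge x y u w)) => [|_]; last first.
  by rewrite andbT.
rewrite -upair_eq => /eqP ->; case/andP: oxy => -> /eqP ->.
by [].
Qed.

(** A pair of [T] that is not unmatched has multiplicity at least 2, since [T] contains only used
    pairs; from there on the truncated exponent grows with every traversal. *)
Lemma other_wt : ~~ unmatched h T x y -> history_wt (a :: h) T = b * history_wt h T.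
Proof.
rewrite /unmatched => nxy; apply: wt_step => //.
case: ifP nxy => [xyT /= m1|_ _]; last by rewrite exprS.
have := tree_used st xyT; case: (multiplicity h _) m1 => [|[|m]] // _ _.
have -> : (m.+3 - 2 = (m.+2 - 2).+1)%N by lia.
by rewrite exprS; ring.
Qed.

Lemma other_excess : ~~ unmatched h T x y ->
  (excess (unmatched (a :: h) T) y <= (excess (unmatched h T) x).+1)%N.
Proof.
move=> nxy; apply: leq_trans (excess_move (unmatched h T) x y).
rewrite eq_leq //; apply: eq_excess => u w; rewrite /unmatched mult_a.
case: (boolP (same_edge x y u w)) => [|_] //; rewrite -upair_eq => /eqP ->.
move: nxy; rewrite /unmatched; case: (boolP (_ \in T)) => //= xyT.
by have := tree_used st xyT; lia.
Qed.

End Step.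

Lemma edge_degree_le h T V x : walk_state h T V x ->
  (edge_degree (unmatched h T) x <= #|V|)%N.
Proof.
move=> st; apply/subset_leq_card/fintype.subsetP => y; rewrite !inE => /andP[_ /eqP m1].
by apply: (visited_mult st (w := x)); rewrite upairC m1.
Qed.

(** [Theta] bounds the number of vertices the walk can ever visit. The factor [Theta ^+ excess] is a
    reserve that pays for the choices among edges to retrace; the three kinds of steps cost 1, 1 and
    [b * Theta ^+ 2], which add up to [lam]. *)
Lemma walk_bound (Theta : nat) : v * n%:R <= 1 ->
  forall m h T V x t par, walk_state h T V x -> (#|V| + m <= Theta)%N ->
  `|expect mu (fun c => (\prod_(a <- h) noise c a.1 a.2) * alt_power m par x t c)|
    <= history_wt h T * (2 + b * Theta%:R ^+ 2) ^+ m
       * Theta%:R ^+ excess (unmatched h T) x.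
Proof.
move=> vn; set lam := 2 + _; elim=> [|m IH] h T V x t par st leTheta.
  have Theta1 : (1 : R) <= Theta%:R.
    rewrite ler1n; apply: leq_trans leTheta.
    by rewrite addn0 card_gt0; apply/set0Pn; exists x; apply: visited_cur st.
  rewrite expr0 mulr1 /= (@eq_expect _ _ _ mu _
    (fun c => (x == t)%:R * \prod_(a <- h) noise c a.1 a.2)); last first.
    by move=> c; rewrite mulrC.
  rewrite expectZ normrM -[leRHS]mul1r.
  apply: ler_pM => //; first by case: eqP; rewrite ?normr1 ?normr0 ?ler01.
  apply: le_trans (history_bound (tree_used st)) _.
  by rewrite ler_peMr ?history_wt_ge0 ?exprn_ege1.
have lam_ge0 : 0 <= lam by rewrite addr_ge0 ?mulr_ge0 ?exprn_ge0.
pose a y := (if par then y else x, if par then x else y).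
have a_xy y : upair (a y).1 (a y).2 = upair x y.
  by rewrite /a {a} /=; case: par => //; rewrite upairC.
rewrite (@eq_expect _ _ _ mu _ (fun c => \sum_y
    (\prod_(e <- a y :: h) noise c e.1 e.2) * alt_power m (~~ par) y t c));
  last first.
  move=> c; rewrite /= mulr_sumr; apply: eq_bigr => y _.
  by rewrite big_cons mulrA; congr (_ * _); rewrite mulrC.
rewrite expect_sum; apply: le_trans (ler_norm_sum _ _ _) _.
set Psi := excess _ _; set W := history_wt h T.
have W0 : 0 <= W by apply: history_wt_ge0.
have cV : (#|V| <= Theta)%N by lia.
have Th0 : (0 : R) <= Theta%:R by [].
have Th1 : (1 : R) <= Theta%:R by rewrite ler1n; lia.
pose K : R := W * lam ^+ m * Theta%:R ^+ Psi.
have K0 : 0 <= K by rewrite !mulr_ge0 ?exprn_ge0.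
have -> : W * lam ^+ m.+1 * Theta%:R ^+ Psi = K + K + b * Theta%:R ^+ 2 * K.
  by rewrite /K exprS /lam; ring.
rewrite (bigID (mem V)) /= (bigID (unmatched h T x)) /= addrC addrA.
apply: lerD; first apply: lerD.
(* New vertices: at most [n] of them, each weighing [v]. *)
- apply: le_trans (_ : \sum_(y | y \notin V) v * K <= _).
    apply: ler_sum => y yV.
    apply: le_trans (IH _ _ _ _ _ _ (new_state st (a_xy y) yV) _) _.
      by rewrite cardsU1 yV; lia.
    by rewrite (new_wt st (a_xy y) yV) (new_excess st (a_xy y) yV) /K !mulrA.
  rewrite sumr_const -mulr_natr -mulrA mulrCA -[leRHS]mulr1 ler_wpM2l //.
  apply: le_trans vn; rewrite ler_wpM2l // ler_nat.
  by rewrite -[leqRHS]card_ord max_card.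
(* Edges to retrace: with [d > 1] choices the excess drops, which gains a factor [Theta^-1 <= d^-1];
   with [d = 1] there is no choice to pay for. *)
- set d := edge_degree (unmatched h T) x.
  apply: le_trans (_ : \sum_(y | (y \in V) && unmatched h T x y) K / d%:R <= _).
    apply: ler_sum => y /andP[yV oxy].
    have d_gt0 : (0 < d)%N by apply/card_gt0P; exists y.
    apply: le_trans (IH _ _ _ _ _ _ (stay_state st (a_xy y) yV) _) _.
      by lia.
    rewrite (close_wt (a_xy y) oxy) /K -!mulrA !ler_wpM2l ?exprn_ge0 //.
    rewrite ler_pdivlMr ?ltr0n //.
    have := close_excess st (a_xy y) oxy; rewrite -/d -/Psi.
    set e := excess _ _; case: (ltnP 1 d) => [d_gt1|d_le1] le_e.
      apply: le_trans (_ : Theta%:R ^+ e.+1 <= _); last first.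
        by rewrite ler_weXn2l //; lia.
      rewrite exprSr ler_wpM2l ?exprn_ge0 // ler_nat.
      exact: leq_trans (edge_degree_le st) cV.
    have -> : d = 1%N by lia.
    by rewrite mulr1 ler_weXn2l //; lia.
  apply: le_trans (_ : \sum_(y | unmatched h T x y) K / d%:R <= _).
    rewrite [leRHS](bigID (mem V)) /= -[leLHS]addr0 lerD //.
      by under eq_bigl do rewrite andbC.
    by apply: sumr_ge0 => y _; rewrite divr_ge0.
  have -> : \sum_(y | unmatched h T x y) K / d%:R = K / d%:R * d%:R.
    by rewrite sumr_const mulr_natr.
  case: (posnP d) => [->|d_gt0]; first by rewrite mulr0.
  by rewrite divfK // pnatr_eq0 -lt0n.
(* All other steps: at most [Theta] targets, a factor [b], and one more [Theta] for the possible
   rise of the excess. *)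
apply: le_trans (_ : \sum_(y | y \in V) b * Theta%:R * K <= _).
  apply: le_trans (_ : \sum_(y | (y \in V) && ~~ unmatched h T x y)
                         b * Theta%:R * K <= _).
    apply: ler_sum => y /andP[yV noxy].
    apply: le_trans (IH _ _ _ _ _ _ (stay_state st (a_xy y) yV) _) _.
      by lia.
    rewrite (other_wt st (a_xy y) noxy) /K -/W.
    have le_e := other_excess st (a_xy y) noxy.
    rewrite [leRHS](_ : _ = b * W * lam ^+ m * Theta%:R ^+ Psi.+1).
      by rewrite ler_wpM2l ?mulr_ge0 ?exprn_ge0 // ler_weXn2l.
    by rewrite exprS; ring.
  rewrite [leRHS](bigID (unmatched h T x)) /= -[leLHS]add0r lerD //.
  by apply: sumr_ge0 => y _; apply: mulr_ge0 (mulr_ge0 b_ge0 Th0) K0.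
rewrite sumr_const -[_ *+ #|V|]mulr_natr [leRHS](_ : _ = b * Theta%:R * K * Theta%:R).
  by rewrite ler_wpM2l ?ler_nat //; apply: mulr_ge0 (mulr_ge0 b_ge0 Th0) K0.
by rewrite expr2; ring.
Qed.

Lemma alt_power_bound (m : nat) (x t : 'I_n) (par : bool) : v * n%:R <= 1 ->
  `|expect mu (fun c => alt_power m par x t c)|
    <= (2 + b * (m.+1)%:R ^+ 2) ^+ m.
Proof.
move=> vn.
have st : walk_state [::] finset.set0 [set x] x.
  by split=> [e|u w||u w]; rewrite ?inE.
(* A walk of [m] steps from one vertex visits at most [m + 1] vertices. *)
have le_m : (#|[set x]| + m <= m.+1)%N by rewrite cards1.
have := walk_bound vn t par st le_m.
rewrite (@eq_expect _ _ _ mu _ (fun c => alt_power m par x t c)); last first.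
  by move=> c; rewrite big_nil mul1r.
move=> le_b; apply: le_trans le_b _.
rewrite (@eq_excess _ _ (fun _ _ => false)) ?excess0 => [|u w]; last first.
  by rewrite /unmatched inE.
by rewrite expr0 mulr1 /history_wt big1 ?mul1r // => e _; rewrite inE expr0.
Qed.

Definition noise_mx c : 'M[R]_n := \matrix_(x, y) noise c x y.

Lemma alt_power_mx k x t c :
  (alt_power k.*2 false x t c) = ((noise_mx c *m (noise_mx c)^T) ^+ k) x t.
Proof.
elim: k x => [|k IH] x; first by rewrite expr0 mxE.
rewrite doubleS exprS mxE; under [RHS]eq_bigr => y _.
  rewrite mxE mulr_suml -IH; over.
rewrite exchange_big /=; apply: eq_bigr => y _; rewrite mulr_sumr.
by apply: eq_bigr => w _; rewrite !mxE mulrA.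
Qed.

Lemma trace_bound k : v * n%:R <= 1 ->
  expect mu (fun c => \tr ((noise_mx c *m (noise_mx c)^T) ^+ k))
    <= n%:R * (2 + b * (k.*2.+1)%:R ^+ 2) ^+ k.*2.
Proof.
move=> vn; rewrite /mxtrace expect_sum.
apply: le_trans (_ : \sum_(i < n) (2 + b * (k.*2.+1)%:R ^+ 2) ^+ k.*2 <= _).
  apply: ler_sum => x _; apply: le_trans (alt_power_bound k.*2 x x false vn).
  apply: le_trans (ler_norm _); rewrite le_eqVlt; apply/orP; left; apply/eqP.
  by apply: eq_expect => c; rewrite alt_power_mx.
by rewrite sumr_const card_ord mulr_natl.
Qed.

End WalkExpectation.

(** * Singular value thresholding *)

Section Frobenius.
Variable R : rcfType.

Definition dotmx m n (A B : 'M[R]_(m, n)) : R := \tr (A *m B^T).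
Definition fnorm m n (A : 'M[R]_(m, n)) : R := Num.sqrt (dotmx A A).

Lemma dotmxE m n (A B : 'M[R]_(m, n)) :
  dotmx A B = \sum_i \sum_j A i j * B i j.
Proof.
apply: eq_bigr => i _; rewrite mxE; apply: eq_bigr => j _.
by rewrite mxE.
Qed.

Lemma dotmxC m n (A B : 'M[R]_(m, n)) : dotmx A B = dotmx B A.
Proof.
by rewrite !dotmxE; under eq_bigr do under eq_bigr do rewrite mulrC.
Qed.

Lemma dotmxDl m n (A B C : 'M[R]_(m, n)) :
  dotmx (A + B) C = dotmx A C + dotmx B C.
Proof. by rewrite /dotmx mulmxDl mxtraceD. Qed.

Lemma dotmxNl m n (A C : 'M[R]_(m, n)) : dotmx (- A) C = - dotmx A C.
Proof. by rewrite /dotmx mulNmx raddfN. Qed.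

Lemma dotmxDr m n (A B C : 'M[R]_(m, n)) :
  dotmx C (A + B) = dotmx C A + dotmx C B.
Proof. by rewrite !(dotmxC C) dotmxDl. Qed.

Lemma dotmxMl m n p (A : 'M[R]_(m, n)) (B : 'M[R]_(n, p)) C :
  dotmx (A *m B) C = dotmx B (A^T *m C).
Proof. by rewrite /dotmx trmx_mul trmxK -mulmxA mxtrace_mulC mulmxA. Qed.

Lemma dotmx_ge0 m n (A : 'M[R]_(m, n)) : 0 <= dotmx A A.
Proof.
rewrite dotmxE; apply: sumr_ge0 => i _; apply: sumr_ge0 => j _.
by rewrite -expr2 sqr_ge0.
Qed.

Lemma fnorm_ge0 m n (A : 'M[R]_(m, n)) : 0 <= fnorm A.
Proof. exact: sqrtr_ge0. Qed.

Lemma sqr_fnorm m n (A : 'M[R]_(m, n)) : fnorm A ^+ 2 = dotmx A A.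
Proof. by rewrite sqr_sqrtr ?dotmx_ge0. Qed.

(** Lagrange's identity: twice the difference of the two sides is the double sum of squares
    below. *)
Lemma cauchy_schwarz_sum (I : finType) (a b : I -> R) :
  (\sum_i a i * b i) ^+ 2 <= (\sum_i a i ^+ 2) * (\sum_i b i ^+ 2).
Proof.
have : 0 <= \sum_i \sum_j (a i * b j - a j * b i) ^+ 2.
  by apply: sumr_ge0 => i _; apply: sumr_ge0 => j _; apply: sqr_ge0.
have -> : \sum_i \sum_j (a i * b j - a j * b i) ^+ 2 =
  \sum_i \sum_j (a i ^+ 2 * b j ^+ 2 + a j ^+ 2 * b i ^+ 2
                 - 2 * ((a i * b i) * (a j * b j))).
  by apply: eq_bigr => i _; apply: eq_bigr => j _; ring.
under eq_bigr do rewrite big_split big_split /=.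
rewrite !big_split /= [X in _ + X + _]exchange_big /=.
under [X in _ + _ + X]eq_bigr do rewrite sumrN -mulr_sumr.
rewrite sumrN -mulr_sumr expr2 !big_distrlr /=; lra.
Qed.

Lemma normr_dotmx m n (A B : 'M[R]_(m, n)) :
  `|dotmx A B| <= fnorm A * fnorm B.
Proof.
rewrite -(@ler_pXn2r _ 2) ?nnegrE ?mulr_ge0 ?fnorm_ge0 //.
rewrite real_normK ?num_real // exprMn !sqr_fnorm !dotmxE !pair_big /=.
exact: cauchy_schwarz_sum.
Qed.

Lemma le_dotmx m n (A B : 'M[R]_(m, n)) : dotmx A B <= fnorm A * fnorm B.
Proof. exact: le_trans (ler_norm _) (normr_dotmx A B). Qed.

Lemma fnormN m n (A : 'M[R]_(m, n)) : fnorm (- A) = fnorm A.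
Proof. by rewrite /fnorm dotmxNl dotmxC dotmxNl opprK. Qed.

Lemma fnormD m n (A B : 'M[R]_(m, n)) : fnorm (A + B) <= fnorm A + fnorm B.
Proof.
rewrite -(@ler_pXn2r _ 2) ?nnegrE ?addr_ge0 ?fnorm_ge0 //.
rewrite sqrrD !sqr_fnorm dotmxDl !dotmxDr (dotmxC B A).
by have := le_dotmx A B; lra.
Qed.

Lemma fnormB m n (A B : 'M[R]_(m, n)) : fnorm (A - B) <= fnorm A + fnorm B.
Proof. by rewrite -(fnormN B) fnormD. Qed.

Lemma dotmx_rows m n (A : 'M[R]_(m, n)) :
  dotmx A A = \sum_i dotmx (row i A) (row i A).
Proof.
rewrite dotmxE; apply: eq_bigr => i _; rewrite dotmxE big_ord1.
by apply: eq_bigr => j _; rewrite mxE.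
Qed.

(** Matrices act on row vectors, so that a product [Q *m D] can be estimated row by row in Frobenius
    norm. *)
Definition opnorm_le m n (D : 'M[R]_(m, n)) (c : R) : Prop :=
  forall w : 'rV_m, fnorm (w *m D) <= c * fnorm w.

Lemma fnorm_mul_opnorm p m n (Q : 'M[R]_(p, m)) (D : 'M[R]_(m, n)) c :
  0 <= c -> opnorm_le D c -> fnorm (Q *m D) <= c * fnorm Q.
Proof.
move=> c0 Dc; rewrite -(@ler_pXn2r _ 2) ?nnegrE ?mulr_ge0 ?fnorm_ge0 //.
rewrite exprMn !sqr_fnorm (dotmx_rows (Q *m D)) (dotmx_rows Q) mulr_sumr.
apply: ler_sum => i _; rewrite row_mul -!sqr_fnorm -exprMn.
by rewrite ler_pXn2r ?nnegrE ?mulr_ge0 ?fnorm_ge0.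
Qed.

Lemma fnorm_mul m n (w : 'rV[R]_m) (D : 'M[R]_(m, n)) :
  fnorm (w *m D) <= fnorm w * fnorm D.
Proof.
rewrite -(@ler_pXn2r _ 2) ?nnegrE ?mulr_ge0 ?fnorm_ge0 //.
rewrite exprMn !sqr_fnorm !dotmxE !big_ord1 exchange_big /= mulr_sumr.
apply: ler_sum => j _; rewrite mxE -expr2.
apply: le_trans (cauchy_schwarz_sum _ _) _.
by rewrite lexx.
Qed.

Lemma opnorm_leM m n p (A : 'M[R]_(m, n)) (B : 'M[R]_(n, p)) a b :
  0 <= b -> opnorm_le A a -> opnorm_le B b -> opnorm_le (A *m B) (a * b).
Proof.
move=> b0 Aa Bb w; rewrite mulmxA; apply: le_trans (Bb _) _.
by rewrite mulrC [leRHS]mulrAC ler_wpM2r.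
Qed.

Lemma opnorm_leB m n (A B : 'M[R]_(m, n)) a b :
  opnorm_le A a -> opnorm_le B b -> opnorm_le (A - B) (a + b).
Proof.
move=> Aa Bb w; rewrite mulmxBr mulrDl; apply: le_trans (fnormB _ _) _.
exact: lerD.
Qed.

Lemma fnorm_isometry p m n (A : 'M[R]_(p, m)) (U : 'M[R]_(m, n)) :
  U *m U^T = 1%:M -> fnorm (A *m U) = fnorm A.
Proof.
by move=> UU; rewrite /fnorm /dotmx trmx_mul mulmxA -(mulmxA A) UU mulmx1.
Qed.

Lemma opnorm_isometry m n (U : 'M[R]_(m, n)) :
  U *m U^T = 1%:M -> opnorm_le U 1.
Proof. by move=> UU w; rewrite fnorm_isometry ?mul1r. Qed.

Lemma opnorm_diag n (d : 'rV[R]_n) c :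
  0 <= c -> (forall j, `|d 0 j| <= c) -> opnorm_le (diag_mx d) c.
Proof.
move=> c0 dc w; rewrite -(@ler_pXn2r _ 2) ?nnegrE ?mulr_ge0 ?fnorm_ge0 //.
rewrite exprMn !sqr_fnorm !dotmxE !big_ord1 mulr_sumr.
apply: ler_sum => j _; rewrite mul_mx_diag mxE -!expr2 exprMn mulrC.
rewrite ler_wpM2r ?sqr_ge0 // -[d 0 j ^+ 2]real_normK ?num_real //.
by rewrite ler_pXn2r ?nnegrE.
Qed.

(* Repeated squaring replaces the spectral theorem, hence the powers of two. *)
Lemma quad_form_trace n j : forall (S : 'M[R]_n) c, S^T = S -> 0 <= c ->
  \tr (S ^+ (2 ^ j.+1)) <= c ^+ (2 ^ j.+1) ->
  forall w : 'rV_n, `|dotmx (w *m S) w| <= c * fnorm w ^+ 2.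
Proof.
elim: j => [|j IH] S c Ssym c0 trS w.
  have NS : fnorm S <= c.
    rewrite -(@ler_pXn2r _ 2) ?nnegrE ?fnorm_ge0 // sqr_fnorm.
    by rewrite /dotmx Ssym.
  apply: le_trans (normr_dotmx _ _) _.
  rewrite expr2 mulrA ler_wpM2r ?fnorm_ge0 //.
  apply: le_trans (fnorm_mul _ _) _.
  by rewrite mulrC ler_wpM2r ?fnorm_ge0.
have sqS : S ^+ 2 = S *m S by rewrite expr2.
have S2sym : (S ^+ 2)^T = S ^+ 2 by rewrite sqS trmx_mul Ssym.
(* The quadratic form of [S ^+ 2] at [w] is the squared norm of [w *m S], because [S] is
   symmetric. *)
have := IH _ (c ^+ 2) S2sym (exprn_ge0 _ c0).
rewrite -!exprM -expnS => /(_ trS w) S2.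
have S2' : fnorm (w *m S) <= c * fnorm w.
  rewrite -(@ler_pXn2r _ 2) ?nnegrE ?mulr_ge0 ?fnorm_ge0 // exprMn.
  apply: le_trans S2; apply: le_trans (ler_norm _).
  by rewrite sqr_fnorm /dotmx trmx_mul Ssym sqS !mulmxA.
apply: le_trans (normr_dotmx _ _) _.
by rewrite expr2 mulrA ler_wpM2r ?fnorm_ge0.
Qed.

(** The quadratic form of [Z *m Z^T] at [w] is the squared norm of [w *m Z]. *)
Lemma opnorm_trace n (Z : 'M[R]_n) (tau : R) j : 0 <= tau ->
  \tr ((Z *m Z^T) ^+ (2 ^ j.+1)) <= (tau ^+ 2) ^+ (2 ^ j.+1) ->
  opnorm_le Z tau.
Proof.
move=> tau0 /quad_form_trace trZ w.
have := trZ _ (exprn_ge0 _ tau0) w; rewrite trmx_mul trmxK => /(_ erefl).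
have -> : dotmx (w *m (Z *m Z^T)) w = fnorm (w *m Z) ^+ 2.
  by rewrite sqr_fnorm /dotmx trmx_mul !mulmxA.
rewrite normrX (ger0_norm (fnorm_ge0 _)) -exprMn.
by rewrite ler_pXn2r ?nnegrE ?mulr_ge0 ?fnorm_ge0.
Qed.

End Frobenius.

(** * Deterministic error of singular value thresholding *)

Section Thresholding.
Variables (R : rcfType) (n : nat).

Lemma sum_outer (I : pred 'I_n) (s : 'I_n -> R) (U V : 'M[R]_n) :
  \sum_(i | I i) s i *: (col i U *m (col i V)^T) =
  U *m diag_mx (\row_i (s i *+ I i)) *m V^T.
Proof.
apply/matrixP => x y; rewrite summxE mxE big_mkcond /=.
apply: eq_bigr => i _; rewrite mul_mx_diag !mxE.
case: (I i); last by rewrite mulr0n mulr0 mul0r.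
by rewrite big_ord1 !mxE mulr1n mulrA (mulrC (s i)).
Qed.

Variables (Y B Z U V Q : 'M[R]_n) (s : 'I_n -> R) (t tau beta rho eps : R).
Hypothesis YE : Y = B + Z.
Hypothesis UU : U^T *m U = 1%:M.
Hypothesis VV : V^T *m V = 1%:M.
Hypothesis s_ge0 : forall i, 0 <= s i.
Hypothesis Ysvd : Y = \sum_i s i *: (col i U *m (col i V)^T).
Hypothesis tau_ge0 : 0 <= tau.
Hypothesis tau_lt : tau < t.
Hypothesis Z_op : opnorm_le Z tau.
Hypothesis B_norm : fnorm B <= beta.
Hypothesis Q_sym : Q^T = Q.
Hypothesis Q_norm : fnorm Q <= rho.
Hypothesis BQ_norm : fnorm (B - Q *m B) <= eps.

Let beta_ge0 : 0 <= beta := le_trans (fnorm_ge0 B) B_norm.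
Let rho_ge0 : 0 <= rho := le_trans (fnorm_ge0 Q) Q_norm.
Let eps_ge0 : 0 <= eps := le_trans (fnorm_ge0 _) BQ_norm.

Let S : pred 'I_n := fun i => t <= s i.
Let D : 'M[R]_n := diag_mx (\row_i (S i)%:R).
Let Dc : 'M[R]_n := diag_mx (\row_i (~~ S i)%:R).
Let Sig : 'M[R]_n := diag_mx (\row_i s i).
Let P := U *m D *m U^T.
Let Pc := U *m Dc *m U^T.
Let A := \sum_(i | S i) s i *: (col i U *m (col i V)^T).
Let W := U *m D *m V^T.
Let N : R := #|S|%:R.

Let UU' : U *m U^T = 1%:M := mulmx1C UU.

Let Y_UV : Y = U *m Sig *m V^T.
Proof. by rewrite Ysvd (sum_outer xpredT). Qed.

Let A_UV : A = U *m (D *m Sig) *m V^T.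
Proof.
rewrite /A sum_outer mulmx_diag; congr (_ *m diag_mx _ *m _).
by apply/rowP => i; rewrite !mxE mulr_natl.
Qed.

Let APY : A = P *m Y.
Proof.
rewrite A_UV Y_UV /P !mulmxA -(mulmxA (U *m D) U^T) UU mulmx1.
by rewrite -!mulmxA.
Qed.

Let P_Pc : P + Pc = 1%:M.
Proof.
rewrite /P /Pc -mulmxDl -mulmxDr -raddfD /=.
rewrite (_ : \row_i _ + \row_i _ = const_mx 1).
  by rewrite diag_const_mx mulmx1.
by apply/rowP => i; rewrite !mxE; case: (S i); rewrite ?addr0 ?add0r.
Qed.

Let D_le1 : opnorm_le D 1.
Proof.
apply: opnorm_diag => // j; rewrite mxE.
by case: (S j); rewrite ?normr1 ?normr0.
Qed.

Let Dc_le1 : opnorm_le Dc 1.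
Proof.
apply: opnorm_diag => // j; rewrite mxE.
by case: (S j); rewrite ?normr1 ?normr0.
Qed.

Let U_le1 : opnorm_le U 1 := opnorm_isometry UU'.
Let UT_le1 : opnorm_le U^T 1.
Proof. by apply: opnorm_isometry; rewrite trmxK. Qed.
Let VT_le1 : opnorm_le V^T 1.
Proof. by apply: opnorm_isometry; rewrite trmxK. Qed.

Let W_le1 : opnorm_le W 1.
Proof.
by have := opnorm_leM ler01 (opnorm_leM ler01 U_le1 D_le1) VT_le1; rewrite !mulr1.
Qed.

Let Pc_le1 : opnorm_le Pc 1.
Proof.
by have := opnorm_leM ler01 (opnorm_leM ler01 U_le1 Dc_le1) UT_le1; rewrite !mulr1.
Qed.

Let t_ge0 : 0 <= t. Proof. exact: le_trans tau_ge0 (ltW tau_lt). Qed.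

Let PcY_le : opnorm_le (Pc *m Y) t.
Proof.
have -> : Pc *m Y = U *m (Dc *m Sig) *m V^T.
  rewrite Y_UV /Pc !mulmxA -(mulmxA (U *m Dc) U^T) UU mulmx1.
  by rewrite -!mulmxA.
rewrite -[t]mul1r -[1 * t]mulr1; do 2?apply: opnorm_leM => //.
rewrite mulmx_diag; apply: opnorm_diag => // j; rewrite !mxE.
case: (boolP (S j)) => Sj; first by rewrite mul0r normr0.
by rewrite mul1r ger0_norm // ltW // ltNge.
Qed.

(** On the discarded left singular directions [Y] has norm at most [t], and [B] differs from [Y] by
    the noise. *)
Let PcB_le : opnorm_le (Pc *m B) (t + tau).
Proof.
have -> : Pc *m B = Pc *m Y - Pc *m Z by rewrite YE mulmxDr addrK.
by apply: opnorm_leB => //; rewrite -[tau]mul1r; apply: opnorm_leM.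
Qed.

Let fnorm_D : fnorm D ^+ 2 = N.
Proof.
rewrite sqr_fnorm /dotmx tr_diag_mx mulmx_diag mxtrace_diag /N.
rewrite -sum1_card natr_sum [RHS]big_mkcond /=; apply: eq_bigr => i _.
by rewrite !mxE unfold_in -[t <= s i]/(S i); case: (S i); rewrite ?mulr1 ?mulr0.
Qed.

Let fnorm_W : fnorm W ^+ 2 = N.
Proof.
rewrite -fnorm_D /W fnorm_isometry ?trmxK // !sqr_fnorm /dotmx.
by rewrite trmx_mul mulmxA mxtrace_mulC !mulmxA UU mul1mx.
Qed.

Let fnorm_P : fnorm P ^+ 2 = N.
Proof.
rewrite -fnorm_D /P fnorm_isometry ?trmxK // !sqr_fnorm /dotmx.
by rewrite trmx_mul mulmxA mxtrace_mulC !mulmxA UU mul1mx.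
Qed.

Let DD : D *m D = D.
Proof.
rewrite mulmx_diag; congr diag_mx; apply/rowP => i; rewrite !mxE.
by case: (S i); rewrite ?mulr1 ?mulr0.
Qed.

Let PW : P *m W = W.
Proof. by rewrite /P /W !mulmxA -(mulmxA (U *m D) U^T) UU mulmx1 -(mulmxA U) DD. Qed.

Let P_sym : P^T = P.
Proof. by rewrite /P !trmx_mul trmxK tr_diag_mx mulmxA. Qed.

Let fnorm_PZ : fnorm (P *m Z) ^+ 2 <= N * tau ^+ 2.
Proof.
rewrite -fnorm_P mulrC -exprMn ler_pXn2r ?nnegrE ?mulr_ge0 ?fnorm_ge0 //.
exact: fnorm_mul_opnorm.
Qed.

(** The pairing is exactly the sum of the kept singular values. *)
Let dot_YW : t * N <= dotmx Y W.
Proof.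
rewrite /dotmx; have -> : Y *m W^T = U *m (Sig *m D) *m U^T.
  rewrite Y_UV /W !trmx_mul trmxK tr_diag_mx !mulmxA.
  by rewrite -(mulmxA _ V^T V) VV mulmx1.
rewrite mxtrace_mulC !mulmxA UU mul1mx mulmx_diag.
rewrite mxtrace_diag /N -sum1_card natr_sum mulr_sumr big_mkcond /=.
apply: ler_sum => i _; rewrite !mxE unfold_in -[t <= s i]/(S i).
by case: (boolP (S i)) => Si; rewrite ?mulr1 ?mulr0.
Qed.

(** Since [P *m W = W], only [P *m Z] meets [W]; both Frobenius norms are of order the square root
    of [N]. This replaces the duality of operator and nuclear norm. *)
Let dot_ZW : dotmx Z W <= tau * N.
Proof.
rewrite -PW -P_sym -dotmxMl; apply: le_trans (le_dotmx _ _) _.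
rewrite -(@ler_pXn2r _ 2) ?nnegrE ?mulr_ge0 ?fnorm_ge0 //.
by rewrite !exprMn fnorm_W [N ^+ 2]expr2 mulrA ler_wpM2r // mulrC.
Qed.

(* Duality with the partial isometry [W] bounds the number [N] of selected
   singular values, as it would with the nuclear norm of [B]. *)
Let rank_le : N * (t - tau) <= beta * rho + eps * fnorm W.
Proof.
have -> : N * (t - tau) = t * N - tau * N by ring.
have : dotmx B W = dotmx Y W - dotmx Z W by rewrite YE dotmxDl addrK.
have BE : B = Q *m B + (B - Q *m B) by rewrite addrC subrK.
rewrite {1}BE dotmxDl dotmxMl Q_sym.
have : dotmx B (Q *m W) <= beta * rho.
  apply: le_trans (le_dotmx _ _) _; apply: ler_pM; rewrite ?fnorm_ge0 //.
  by apply: le_trans (fnorm_mul_opnorm _ ler01 W_le1) _; rewrite mul1r.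
have : dotmx (B - Q *m B) W <= eps * fnorm W.
  by apply: le_trans (le_dotmx _ _) _; rewrite ler_wpM2r ?fnorm_ge0.
by have := dot_YW; have := dot_ZW; lra.
Qed.

(** The term [eps * fnorm W] grows only like the square root of [N] and is absorbed on the left by
    completing a square. *)
Let rank_le2 : N * (t - tau) <= 2 * beta * rho + eps ^+ 2 / (t - tau).
Proof.
set d := t - tau; have d_gt0 : 0 < d by rewrite subr_gt0.
have := rank_le; rewrite -/d.
have : 0 <= (fnorm W * d - eps) ^+ 2 / d by rewrite divr_ge0 ?sqr_ge0 // ltW.
have -> : (fnorm W * d - eps) ^+ 2 / d =
  N * d - 2 * (eps * fnorm W) + eps ^+ 2 / d.
  by rewrite -fnorm_W; field; apply: lt0r_neq0.
lra.
Qed.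

(** As [Pc] is an orthogonal projection, the left side is the pairing of [B] with [Pc *m B]. In the
    part [Q *m B] the symmetric [Q] is moved to the other factor, which costs [rho] times an
    operator norm; the remainder is absorbed by a square. *)
Let fnorm_PcB : fnorm (Pc *m B) ^+ 2 <= 2 * rho * (t + tau) * beta + eps ^+ 2.
Proof.
have tt : 0 <= t + tau by apply: addr_ge0.
have Pc_sym : Pc^T = Pc by rewrite /Pc !trmx_mul trmxK tr_diag_mx mulmxA.
have PcPc : Pc *m Pc = Pc.
  rewrite /Pc !mulmxA -(mulmxA (U *m Dc) U^T) UU mulmx1 -(mulmxA U).
  rewrite mulmx_diag; congr (_ *m diag_mx _ *m _); apply/rowP => i.
  by rewrite !mxE; case: (S i); rewrite ?mulr1 ?mulr0.
have E1 : fnorm (Pc *m B) ^+ 2 = dotmx B (Pc *m B).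
  by rewrite sqr_fnorm dotmxMl Pc_sym mulmxA PcPc.
have BE : B = Q *m B + (B - Q *m B) by rewrite addrC subrK.
have : fnorm (Pc *m B) ^+ 2 <= beta * ((t + tau) * rho) + eps * fnorm (Pc *m B).
  rewrite {1}E1 {1}BE dotmxDl dotmxMl Q_sym; apply: lerD.
    apply: le_trans (le_dotmx _ _) _; apply: ler_pM; rewrite ?fnorm_ge0 //.
    apply: le_trans (fnorm_mul_opnorm _ tt PcB_le) _.
    by rewrite ler_wpM2l.
  by apply: le_trans (le_dotmx _ _) _; rewrite ler_wpM2r ?fnorm_ge0.
have := sqr_ge0 (fnorm (Pc *m B) - eps); rewrite sqrrB.
set f := fnorm _; set f2 := f ^+ 2; set e2 := eps ^+ 2; nra.
Qed.

(** The error is [P *m Z - Pc *m B]: noise on the [N] kept directions, signal on the discarded ones.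
    It is applied with [B] equal to [p *: M]. *)
Lemma threshold_error :
  fnorm (A - B) ^+ 2 <=
    2 * tau ^+ 2 * (2 * beta * rho / (t - tau) + eps ^+ 2 / (t - tau) ^+ 2)
    + 2 * (2 * rho * (t + tau) * beta + eps ^+ 2).
Proof.
set d := t - tau; have d_gt0 : 0 < d by rewrite subr_gt0.
have N_le : N <= 2 * beta * rho / d + eps ^+ 2 / d ^+ 2.
  have -> : 2 * beta * rho / d + eps ^+ 2 / d ^+ 2 =
    (2 * beta * rho + eps ^+ 2 / d) / d by field; apply: lt0r_neq0.
  by rewrite ler_pdivlMr // rank_le2.
have -> : A - B = P *m Z - Pc *m B.
  rewrite APY YE mulmxDr -[X in _ - X = _]mul1mx -P_Pc mulmxDl.
  by rewrite opprD addrACA subrr add0r.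
apply: le_trans (_ : 2 * fnorm (P *m Z) ^+ 2 + 2 * fnorm (Pc *m B) ^+ 2 <= _).
  apply: le_trans (_ : (fnorm (P *m Z) + fnorm (Pc *m B)) ^+ 2 <= _).
    by rewrite ler_pXn2r ?nnegrE ?addr_ge0 ?fnorm_ge0 ?fnormB.
  have := sqr_ge0 (fnorm (P *m Z) - fnorm (Pc *m B)).
  by rewrite sqrrB sqrrD; lra.
apply: lerD; last by rewrite ler_wpM2l.
rewrite -mulrA ler_wpM2l //; apply: le_trans fnorm_PZ _.
by rewrite mulrC ler_wpM2l ?sqr_ge0.
Qed.

End Thresholding.

(** * Approximation of monotone matrices *)

Section BlockAverage.
Variables (R : rcfType) (n : nat) (grp : 'I_n -> nat) (r g : nat).
Hypothesis grp_lt : forall i, (grp i < r)%N.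
Hypothesis grp_size : forall a, (#|[pred i | grp i == a]| <= g)%N.

Let gsize i : R := #|[pred l | grp l == grp i]|%:R.

Definition block_average : 'M[R]_n := \matrix_(i, j) ((grp j == grp i)%:R / gsize i).

Let gsize_gt0 i : 0 < gsize i.
Proof. by rewrite ltr0n; apply/card_gt0P; exists i; rewrite !inE. Qed.

Lemma block_average_sym : block_average^T = block_average.
Proof.
apply/matrixP => i j; rewrite !mxE eq_sym; case: eqP => [eqg|_].
  by rewrite /gsize eqg.
by rewrite !mul0r.
Qed.

Lemma block_average_row i : \sum_j block_average i j = 1.
Proof.
under eq_bigr do rewrite mxE.
rewrite -mulr_suml -natr_sum (_ : (\sum_j _)%N = #|[pred l | grp l == grp i]|).
  by rewrite -/(gsize i) mulfV // lt0r_neq0.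
rewrite -sum1_card [RHS]big_mkcond; apply: eq_bigr => j _; rewrite inE.
by case: eqP.
Qed.

Lemma sum_by_group (F : nat -> R) : (forall a, 0 <= F a) ->
  \sum_(i < n) F (grp i) <= g%:R * \sum_(a < r) F a.
Proof.
move=> F0; pose G i := Ordinal (grp_lt i).
rewrite (partition_big G xpredT) //= mulr_sumr; apply: ler_sum => a _.
apply: le_trans (_ : \sum_(i | G i == a) F a <= _).
  by apply: ler_sum => i /eqP <-.
rewrite sumr_const -[leLHS]mulr_natl ler_wpM2r // ler_nat.
by apply: leq_trans (grp_size a); rewrite subset_leq_card //; apply/fintype.subsetP.
Qed.

(** Each nonempty group contributes exactly 1: the matrix is the orthogonal projection onto vectors
    constant on groups. *)
Lemma block_average_norm : fnorm block_average ^+ 2 <= r%:R.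
Proof.
rewrite sqr_fnorm dotmxE.
have -> : \sum_i \sum_j block_average i j * block_average i j = \sum_i (gsize i)^-1.
  apply: eq_bigr => i _; rewrite -[RHS]mul1r -(block_average_row i) mulr_suml.
  apply: eq_bigr => j _; rewrite !mxE.
  by case: eqP => _; rewrite ?mul1r ?mul0r.
pose G i := Ordinal (grp_lt i).
rewrite (partition_big G xpredT) //=.
apply: le_trans (_ : \sum_(a < r) 1 <= _); last by rewrite sumr_const card_ord.
apply: ler_sum => a _; case: (pickP [pred i | G i == a]) => [i0 /= /eqP Gi0|no].
  rewrite (eq_bigr (fun=> (gsize i0)^-1)) => [|i /eqP Gi]; last first.
    by rewrite /gsize (_ : grp i = grp i0) //; have := Gi; rewrite -Gi0 => -[].
  rewrite sumr_const -[_ *+ _]mulr_natl (_ : #|_|%:R = gsize i0).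
    by rewrite mulfV // lt0r_neq0.
  by congr (_%:R); apply: eq_card => i; rewrite !inE -Gi0.
by rewrite big_pred0 // => i; apply: no.
Qed.

End BlockAverage.

Section MonotoneApproximation.
Variables (R : rcfType) (n : nat) (q : 'I_n -> 'I_n -> R).
Variables (stronger : rel 'I_n) (g : nat).
Hypothesis q01 : forall i j, i != j -> 0 <= q i j <= 1.
Hypothesis st_irr : irreflexive stronger.
Hypothesis st_trans : transitive stronger.
Hypothesis st_total : forall x y, x != y -> stronger x y || stronger y x.
Hypothesis q_mono : forall i j k, stronger i j -> k != i -> k != j -> q j k <= q i k.
Hypothesis g_gt0 : (0 < g)%N.

(** Rank 0 is the strongest team, so off-diagonal entries of a column decrease as the rank grows. *)
Definition rank_of i : nat := #|[pred j | stronger j i]|.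
Definition rank_group i : nat := (rank_of i %/ g)%N.

Let M : 'M[R]_n := \matrix_(i, j) if i == j then 0 else q i j.

Lemma rank_lt i j : stronger i j -> (rank_of i < rank_of j)%N.
Proof.
move=> ij; apply/proper_card/properP; split.
  by apply/fintype.subsetP => l; rewrite !inE => /st_trans; apply.
by exists i; rewrite !inE ?st_irr.
Qed.

Lemma rank_inj : injective rank_of.
Proof.
move=> i j eqr; apply/eqP; apply: contraT => /st_total /orP[] /rank_lt;
  by rewrite eqr ltnn.
Qed.

Lemma rank_group_lt i : (rank_group i < (n %/ g).+1)%N.
Proof.
rewrite ltnS; apply: leq_div2r; rewrite -[leqRHS]card_ord; exact: max_card.
Qed.

(** Inside a group the rank is determined by its residue modulo [g]. *)
Lemma rank_group_size a : (#|[pred i | rank_group i == a]| <= g)%N.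
Proof.
pose f i : 'I_g := Ordinal (ltn_pmod (rank_of i) g_gt0).
rewrite -(@card_in_image _ _ f) => [|i j].
  by rewrite -[leqRHS]card_ord max_card.
rewrite !inE => /eqP gi /eqP gj [] eqm; apply: rank_inj.
by rewrite (divn_eq (rank_of i) g) (divn_eq (rank_of j) g) eqm
  -/(rank_group i) -/(rank_group j) gi gj.
Qed.

(* Rows of one group differ in column [k] by at most
   [tops k a - tops k a.+1], and these increments telescope. *)
Let tops k a : R :=
  \big[Num.max/0]_(i | (i != k) && (a <= rank_group i)%N) q i k.

Let top_ge0 k a : 0 <= tops k a.
Proof. by rewrite /tops; elim/big_rec: _ => // i x _ x0; rewrite le_max x0 orbT. Qed.

Let top_le k a c : 0 <= c ->
  (forall i, i != k -> (a <= rank_group i)%N -> q i k <= c) -> tops k a <= c.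
Proof.
move=> c0 qc; rewrite /tops; elim/big_ind: _ => // [x y xc yc|i /andP[]].
  by rewrite ge_max xc.
exact: qc.
Qed.

Let le_top k a i : i != k -> (a <= rank_group i)%N -> q i k <= tops k a.
Proof.
move=> ik ai; rewrite /tops (bigD1 i) ?ik //=.
by rewrite le_max lexx.
Qed.

Let top_anti k a : tops k a.+1 <= tops k a.
Proof. by apply: top_le => // i ik ai; apply: le_top => //; apply: ltnW. Qed.

Let top_le_q k j : j != k -> tops k (rank_group j).+1 <= q j k.
Proof.
move=> jk; apply: top_le => [|i ik ji]; first by case/andP: (q01 jk).
have rji : (rank_of j < rank_of i)%N.
  by rewrite ltnNge; apply: contraL ji => /(leq_div2r g); rewrite -leqNgt.
apply: q_mono; rewrite 1?eq_sym //.
have /st_total : j != i by apply: contraTneq rji => ->; rewrite ltnn.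
by case/orP => // /rank_lt; rewrite ltnNge ltnW.
Qed.

Let Q := block_average R rank_group.

(** The zero diagonal breaks monotonicity of column [k] only in the group of [k], where the trivial
    bound 1 is used. In any other group the entries, hence also their average, lie between two
    consecutive values of [tops]. *)
Let resid i k : `|(M - Q *m M) i k| <=
  if rank_group i == rank_group k then 1
  else tops k (rank_group i) - tops k (rank_group i).+1.
Proof.
have -> : (M - Q *m M) i k = \sum_j Q i j * (M i k - M j k).
  rewrite [LHS]mxE [X in _ + X]mxE [X in _ - X]mxE.
  under [RHS]eq_bigr do rewrite mulrBr.
  by rewrite sumrB -mulr_suml block_average_row mul1r.
apply: le_trans (ler_norm_sum _ _ _) _.
rewrite -[leRHS]mul1r -[X in _ <= X * _](block_average_row R rank_group i) mulr_suml.
apply: ler_sum => j _; rewrite normrM mxE.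
case: eqP => [gji|_]; last by rewrite mul0r normr0 !mul0r.
rewrite ger0_norm ?divr_ge0 // ler_wpM2l ?divr_ge0 //.
have M01 x : 0 <= M x k <= 1.
  by rewrite mxE; case: ifP => [_|/negbT /q01 //]; rewrite lexx ler01.
case: eqP => [_|gik].
  move: (M01 i) (M01 j); move: (M i k) (M j k) => u w /andP[? ?] /andP[? ?].
  by rewrite ler_norml; apply/andP; split; lra.
have ik : i != k by apply/eqP => ik; case: gik; rewrite ik.
have jk : j != k by apply/eqP => jk; case: gik; rewrite -gji jk.
have := le_top ik (leqnn _); have := le_top jk (leqnn _).
have := top_le_q ik; have := top_le_q jk; rewrite gji.
rewrite !mxE (negPf ik) (negPf jk) ler_norml.
by move=> ? ? ? ?; apply/andP; split; lra.
Qed.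

(** Residuals are at most 1, so their squares are bounded by the residuals themselves. Per column,
    the group of [k] and the telescoping increments contribute at most 1 each, repeated for at most
    [g] rows. *)
Lemma block_average_error : fnorm (M - Q *m M) ^+ 2 <= (2 * n * g)%:R.
Proof.
rewrite sqr_fnorm dotmxE exchange_big /=.
apply: le_trans (_ : \sum_(k < n) (2 * g)%:R <= _); last first.
  by rewrite sumr_const card_ord -mulrnA ler_nat; lia.
apply: ler_sum => k _.
pose F a : R := (a == rank_group k)%:R + (tops k a - tops k a.+1).
have F0 a : 0 <= F a by rewrite addr_ge0 // subr_ge0.
apply: le_trans (_ : \sum_(i < n) F (rank_group i) <= _).
  apply: ler_sum => i _; rewrite -expr2 -real_normK ?num_real //.
  have top1 a : tops k a <= 1.
    by apply: top_le => // j jk _; case/andP: (q01 jk).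
  apply: le_trans (_ : `|(M - Q *m M) i k| <= _).
    rewrite expr2 -[leRHS]mul1r ler_wpM2r //; apply: le_trans (resid i k) _.
    by case: ifP => // _; have := top1 (rank_group i);
      have := top_ge0 k (rank_group i).+1; lra.
  apply: le_trans (resid i k) _; rewrite /F.
  by case: eqP; rewrite ?add0r // lerDl subr_ge0.
apply: le_trans (sum_by_group rank_group_lt rank_group_size F0) _.
rewrite mulnC natrM ler_wpM2l // /F big_split /=; apply: (@lerD _ _ 1 _ 1).
  rewrite (bigD1 (Ordinal (rank_group_lt k))) //= eqxx big1 ?addr0 // => a.
  by rewrite -val_eqE /= => /negPf ->.
under eq_bigr do rewrite -opprB.
rewrite sumrN -(big_mkord xpredT (fun a => tops k a.+1 - tops k a)).
rewrite telescope_sumr // opprB.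
have top1 : tops k 0 <= 1 by apply: top_le => // j jk _; case/andP: (q01 jk).
by have := top_ge0 k (n %/ g).+1; lra.
Qed.

End MonotoneApproximation.

(** * The law of the data *)

Section Model.
Variables (R : realFieldType) (n K : nat) (q : 'I_n -> 'I_n -> R) (p : R).
Variable N : 'I_n -> 'I_n -> nat.
Hypothesis N_le : forall i j, (N i j <= K)%N.
Hypothesis N_gt0 : forall i j, i != j -> (0 < N i j)%N.
Hypothesis q_win : forall i j, i != j -> 0 <= q i j <= 1 /\ q j i = 1 - q i j.
Hypothesis p01 : 0 <= p <= 1.

Local Notation block := ({ffun option 'I_K -> bool}).

(** [None] stands for the observation of the pair, [Some k] for its game [k]. Cells without a source
    get probability 0, so that all blocks have the same shape. *)
Definition cell_prob (e : 'I_n * 'I_n) (o : option 'I_K) : R :=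
  match o with
  | None => if (e.1 <= e.2)%N then p else 0
  | Some k => if (e.1 < e.2)%N && (k < N e.1 e.2)%N then q e.1 e.2 else 0
  end.

Definition cell_wt e o (b : bool) : R :=
  if b then cell_prob e o else 1 - cell_prob e o.

Definition block_wt e (d : block) : R := \prod_o cell_wt e o (d o).

Lemma cell_prob01 e o : 0 <= cell_prob e o <= 1.
Proof.
case: o => [k|] /=; case: ifP => // h; rewrite ?lexx ?ler01 //.
have e12 : e.1 != e.2 by case/andP: h; case: e => i j /=; rewrite ltn_neqAle => /andP[].
by have [] := q_win e12.
Qed.

Lemma cell_wt_ge0 e o b : 0 <= cell_wt e o b.
Proof.
by rewrite /cell_wt; have /andP[? ?] := cell_prob01 e o; case: b; rewrite ?subr_ge0.
Qed.

Lemma cell_wt_sum1 e o : \sum_b cell_wt e o b = 1.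
Proof. by rewrite big_bool /cell_wt /= addrC subrK. Qed.

Lemma block_wt_ge0 e d : 0 <= block_wt e d.
Proof. by apply: prodr_ge0 => o _; apply: cell_wt_ge0. Qed.

Lemma block_wtE e F : \sum_d F d * block_wt e d = expect (cell_wt e) F.
Proof. by []. Qed.

Lemma block_wt_sum1 e : \sum_d block_wt e d = 1.
Proof.
rewrite -(expect_cst (cell_wt_sum1 e) 1) -block_wtE.
by apply: eq_bigr => d _; rewrite mul1r.
Qed.

Lemma expect_cell e o : expect (cell_wt e) (fun d => (d o)%:R) = cell_prob e o.
Proof.
rewrite (expect_block (cell_wt_sum1 e) o (fun b : bool => b%:R)).
by rewrite big_bool /= mul1r mul0r addr0.
Qed.

Lemma expect_cell2 e o o' : o != o' ->
  expect (cell_wt e) (fun d => (d o)%:R * (d o')%:R) =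
  cell_prob e o * cell_prob e o'.
Proof.
move=> oo'; pose f (b : bool) : R := b%:R.
rewrite (expect_indep (cell_wt_sum1 e) f f oo').
by rewrite !expect_cell.
Qed.

Definition win_ratio (e : 'I_n * 'I_n) (d : block) : R :=
  (\sum_(k < K | (k < N e.1 e.2)%N) (d (Some k))%:R) / (N e.1 e.2)%:R.

Definition entry (i j : 'I_n) (d : block) : R :=
  if i == j then 0 else
  (d None)%:R * (if (i < j)%N then win_ratio (i, j) d else 1 - win_ratio (j, i) d).

Definition mean_entry (i j : 'I_n) : R := if i == j then 0 else q i j.

Definition centred i j d : R := entry i j d - p * mean_entry i j.

Lemma sum_games e (c : R) : \sum_(k < K | (k < N e.1 e.2)%N) c = c * (N e.1 e.2)%:R.
Proof.
rewrite -(big_ord_widen K (fun=> c) (N_le e.1 e.2)).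
by rewrite sumr_const card_ord mulr_natr.
Qed.

Lemma win_ratio01 (e : 'I_n * 'I_n) d : e.1 != e.2 -> 0 <= win_ratio e d <= 1.
Proof.
move=> e12; have N0 : (0 : R) < (N e.1 e.2)%:R by rewrite ltr0n N_gt0.
apply/andP; split; first by rewrite divr_ge0 // sumr_ge0.
rewrite ler_pdivrMr // -sum_games; apply: ler_sum => k _.
by case: (d _).
Qed.

Lemma entry01 i j d : 0 <= entry i j d <= 1.
Proof.
rewrite /entry; case: eqP => [_|/eqP ij]; first by rewrite lexx ler01.
have ji : j != i by rewrite eq_sym.
have /andP[a1 a2] := @win_ratio01 (i, j) d ij.
have /andP[b1 b2] := @win_ratio01 (j, i) d ji.
case: (d None); rewrite ?mul1r ?mul0r ?lexx ?ler01 //.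
case: ifP => _; apply/andP; split=> //; lra.
Qed.

Lemma mean_entry01 i j : 0 <= mean_entry i j <= 1.
Proof.
rewrite /mean_entry; case: eqP => [_|/eqP ij]; first by rewrite lexx ler01.
by have [] := q_win ij.
Qed.

Lemma expect_win_ratio (e : 'I_n * 'I_n) : (e.1 < e.2)%N ->
  expect (cell_wt e) (fun d => (d None)%:R * win_ratio e d) = p * q e.1 e.2.
Proof.
move=> e12; have Ne : (N e.1 e.2)%:R != 0 :> R.
  rewrite pnatr_eq0 -lt0n N_gt0 //.
  by case: e e12 => i j /=; rewrite ltn_neqAle => /andP[].
transitivity (expect (cell_wt e) (fun d => (N e.1 e.2)%:R^-1 *
    \sum_(k < K | (k < N e.1 e.2)%N) (d None)%:R * (d (Some k))%:R)).
  by apply: eq_expect => d; rewrite -mulr_sumr /win_ratio; ring.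
rewrite expectZ expect_sum.
rewrite (eq_bigr (fun=> p * q e.1 e.2)) => [|k kN].
  by rewrite sum_games mulrC mulfK.
by rewrite expect_cell2 //= e12 kN (ltnW e12).
Qed.

Lemma entry_mean i j :
  \sum_d entry i j d * block_wt (upair i j) d = p * mean_entry i j.
Proof.
rewrite block_wtE /mean_entry /entry; case: eqP => [_|/eqP ij].
  by rewrite mulr0 expect_cst //; apply: cell_wt_sum1.
rewrite /upair; case: (ltngtP i j) => [lt_ij|lt_ji|/ord_inj eij].
- by rewrite expect_win_ratio.
- transitivity (expect (cell_wt (j, i)) (fun d => (d None)%:R +
      -1 * ((d None)%:R * win_ratio (j, i) d))).
    by apply: eq_expect => d; ring.
  rewrite expectD expectZ expect_win_ratio // expect_cell /= (ltnW lt_ji).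
  by have [_ ->] := q_win ij; ring.
- by rewrite eij eqxx in ij.
Qed.

Lemma centred_mean i j : \sum_d centred i j d * block_wt (upair i j) d = 0.
Proof.
rewrite /centred; under eq_bigr do rewrite mulrBl.
by rewrite sumrB -mulr_sumr block_wt_sum1 entry_mean mulr1 subrr.
Qed.

Lemma centred_bound i j d : `|centred i j d| <= 1.
Proof.
rewrite /centred; have /andP[a1 a2] := entry01 i j d.
have /andP[b1 b2] := mean_entry01 i j; have /andP[c1 c2] := p01.
have : p * mean_entry i j <= 1 * 1 by apply: ler_pM.
have : 0 <= p * mean_entry i j by apply: mulr_ge0.
by move=> ? ?; rewrite ler_norml; apply/andP; split; lra.
Qed.

(** Entries lie in [0, 1], so the second moment is at most the mean [m], and [m <= p]. *)
Lemma centred_var i j :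
  \sum_d centred i j d ^+ 2 * block_wt (upair i j) d <= p.
Proof.
have /andP[c1 c2] := p01; have /andP[b1 b2] := mean_entry01 i j.
set m := p * mean_entry i j.
have m0 : 0 <= m by apply: mulr_ge0.
have mp : m <= p by rewrite ler_piMr.
apply: le_trans (_ : \sum_d (entry i j d * block_wt (upair i j) d
   - 2 * m * (entry i j d * block_wt (upair i j) d) + m ^+ 2 * block_wt (upair i j) d) <= _).
  apply: ler_sum => d _; rewrite /centred -/m.
  have -> : entry i j d * block_wt (upair i j) d
    - 2 * m * (entry i j d * block_wt (upair i j) d) + m ^+ 2 * block_wt (upair i j) d
    = (entry i j d - 2 * m * entry i j d + m ^+ 2) * block_wt (upair i j) d by ring.
  apply: ler_wpM2r; first exact: block_wt_ge0.
  have /andP[a1 a2] := entry01 i j d; rewrite sqrrB.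
  have : entry i j d ^+ 2 <= entry i j d by rewrite expr2 ler_piMr.
  by rewrite -mulr_natl; lra.
rewrite big_split sumrB /= -!mulr_sumr entry_mean block_wt_sum1 -/m.
have := sqr_ge0 m; rewrite mulr1 expr2 -mulrA; lra.
Qed.

Definition nb_upper : R := #|[set ij : 'I_n * 'I_n | (ij.1 <= ij.2)%N]%SET|%:R.

Definition observed_rate (c : {ffun 'I_n * 'I_n -> block}) : R :=
  (\sum_(e : 'I_n * 'I_n | (e.1 <= e.2)%N) (c e None)%:R) / nb_upper.

Lemma nb_upper_ge : n%:R <= nb_upper.
Proof.
rewrite ler_nat -[leqLHS]card_ord -(card_imset _ (f := fun i : 'I_n => (i, i))).
  apply/subset_leq_card/fintype.subsetP => e /imsetP[i _ ->].
  by rewrite inE.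
by move=> i j [].
Qed.

(** Covariances of distinct pairs vanish and each variance is at most [p]; counting just the
    diagonal in [nb_upper] is precise enough. *)
Lemma observed_rate_var : (0 < n)%N ->
  expect block_wt (fun c => (observed_rate c - p) ^+ 2) <= p / n%:R.
Proof.
move=> n0; have nR : (0 : R) < n%:R by rewrite ltr0n.
have U0 : 0 < nb_upper by apply: lt_le_trans nb_upper_ge.
have /andP[c1 c2] := p01.
pose S (e : 'I_n * 'I_n) (c : {ffun 'I_n * 'I_n -> block}) := (c e None)%:R - p : R.
have rateE c : (observed_rate c - p) ^+ 2 = nb_upper ^- 2 *
    \sum_(e : 'I_n * 'I_n | (e.1 <= e.2)%N)
    \sum_(e' : 'I_n * 'I_n | (e'.1 <= e'.2)%N) S e c * S e' c.
  have -> : observed_rate c - p =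
    (\sum_(e : 'I_n * 'I_n | (e.1 <= e.2)%N) S e c) / nb_upper.
    rewrite /S sumrB mulrBl; congr (_ - _).
    rewrite sumr_const -[p *+ _]mulr_natr (_ : #|_|%:R = nb_upper).
      by rewrite mulfK // lt0r_neq0.
    by congr (_%:R); apply: eq_card => e; rewrite !inE.
  by rewrite exprMn exprVn mulrC; congr (_ * _); rewrite expr2 big_distrlr.
rewrite (eq_expect _ rateE) expectZ expect_sum.
have S0 (e : 'I_n * 'I_n) : (e.1 <= e.2)%N -> expect block_wt (S e) = 0.
  move=> le_e; rewrite /S expectD (expect_cst block_wt_sum1).
  rewrite (expect_block block_wt_sum1 e (fun d : block => (d None)%:R)).
  by rewrite block_wtE expect_cell /= le_e subrr.
have S2 (e : 'I_n * 'I_n) : (e.1 <= e.2)%N ->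
    expect block_wt (fun c => S e c * S e c) <= p.
  move=> le_e; rewrite /S.
  rewrite (expect_block block_wt_sum1 e
    (fun d : block => ((d None)%:R - p) * ((d None)%:R - p))).
  rewrite block_wtE.
  rewrite (expect_block (cell_wt_sum1 e) None (fun b : bool => (b%:R - p) * (b%:R - p))).
  rewrite big_bool /cell_wt /= le_e /=; nra.
rewrite (eq_bigr (fun e => expect block_wt (fun c => S e c * S e c))); last first.
  move=> e le_e; rewrite expect_sum (bigD1 e) //= big1 ?addr0 // => e' /andP[le_e' ne].
  rewrite (expect_indep block_wt_sum1 (fun d : block => (d None)%:R - p)
    (fun d : block => (d None)%:R - p)) 1?eq_sym //.
  by rewrite (S0 e le_e) mul0r.
apply: le_trans (_ : nb_upper ^- 2 * (nb_upper * p) <= _).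
  rewrite ler_wpM2l ?invr_ge0 ?exprn_ge0 ?(ltW U0) //.
  apply: le_trans (_ : \sum_(e : 'I_n * 'I_n | (e.1 <= e.2)%N) p <= _).
    exact: ler_sum.
  rewrite sumr_const -[p *+ _]mulr_natl le_eqVlt; apply/orP; left; apply/eqP.
  by congr (_%:R * _); apply: eq_card => e; rewrite !inE.
have -> : nb_upper ^- 2 * (nb_upper * p) = p / nb_upper.
  by field; apply: lt0r_neq0.
by rewrite ler_wpM2l // lef_pV2 ?posrE // nb_upper_ge.
Qed.

End Model.

Lemma truncate_dist (R : realType) (w m : R) :
  0 <= m <= 1 -> (truncate w - m) ^+ 2 <= (w - m) ^+ 2.
Proof.
rewrite /truncate => /andP[m0 m1]; case: ifP => [w1|_].
  by rewrite ler_pXn2r ?nnegrE ?subr_ge0 //; lra.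
case: ifP => [w1|_]; last by [].
rewrite -[_ ^+ 2]sqrrN -[(w - m) ^+ 2]sqrrN ler_pXn2r ?nnegrE //; lra.
Qed.

Lemma truncate_bound (R : realType) (w m : R) :
  0 <= m <= 1 -> (truncate w - m) ^+ 2 <= 4.
Proof.
rewrite /truncate => /andP[m0 m1].
by case: ifP => w1; [|case: ifP => w2]; nra.
Qed.

(** * Risk of the estimator *)

Section Pointwise.
Variables (R : realType) (n : nat) (eta p : R) (X : 'M[option R]_n).
Variables (M Mhat Q : 'M[R]_n) (rho eps : R).
Hypothesis n_gt0 : (0 < n)%N.
Hypothesis eta01 : 0 < eta < 1.
Hypothesis p01 : 0 < p <= 1.
Hypothesis M01 : forall i j, 0 <= M i j <= 1.
Hypothesis usvtM : is_usvt eta X Mhat.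

Lemma usvt_loss_le4 :
  (n%:R ^+ 2)^-1 * (\sum_i \sum_j (Mhat i j - M i j) ^+ 2) <= 4.
Proof.
have n0 : (0 : R) < n%:R ^+ 2 by rewrite exprn_gt0 // ltr0n.
rewrite mulrC ler_pdivrMr //.
have [s [U [V [_ ->]]]] := usvtM.
apply: le_trans (_ : \sum_(i < n) \sum_(j < n) 4 <= _).
  by apply: ler_sum => i _; apply: ler_sum => j _; rewrite mxE truncate_bound.
by rewrite !sumr_const card_ord -mulrnA -[leLHS]mulr_natr natrM expr2.
Qed.

Let sigma := Num.sqrt (n%:R * p).

Hypothesis Z_op : opnorm_le (zero_filled X - p *: M) ((2 + eta / 2) * sigma).
Hypothesis phat_close : `|phat X - p| <= eta / 16 * p.
Hypothesis Q_sym : Q^T = Q.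
Hypothesis Q_norm : fnorm Q <= rho.
Hypothesis MQ_norm : fnorm (M - Q *m M) <= eps.

Let p_gt0 : 0 < p. Proof. by case/andP: p01. Qed.
Let nR_gt0 : (0 : R) < n%:R. Proof. by rewrite ltr0n. Qed.
Let sigma_gt0 : 0 < sigma. Proof. by rewrite sqrtr_gt0 mulr_gt0. Qed.
Let sigma2 : sigma ^+ 2 = n%:R * p.
Proof. by rewrite sqr_sqrtr // mulr_ge0 // ltW. Qed.
Let rho_ge0 : 0 <= rho := le_trans (fnorm_ge0 Q) Q_norm.
Let eps_ge0 : 0 <= eps := le_trans (fnorm_ge0 _) MQ_norm.

Let fnorm_M : fnorm M <= n%:R.
Proof.
rewrite -(@ler_pXn2r _ 2) ?nnegrE ?fnorm_ge0 // sqr_fnorm dotmxE.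
apply: le_trans (_ : \sum_(i < n) \sum_(j < n) 1 <= _).
  apply: ler_sum => i _; apply: ler_sum => j _.
  by have /andP[? ?] := M01 i j; rewrite mulr_ile1.
by rewrite !sumr_const card_ord -mulrnA natrM expr2.
Qed.

Let fnormZ (a : R) (A : 'M[R]_n) : 0 <= a -> fnorm (a *: A) = a * fnorm A.
Proof.
move=> a0; apply/eqP; rewrite -(@eqrXn2 _ 2) ?mulr_ge0 ?fnorm_ge0 //.
rewrite exprMn !sqr_fnorm /dotmx linearZ /= -scalemxAl -scalemxAr.
by rewrite !mxtraceZ expr2 mulrA.
Qed.

Let t := (2 + eta) * Num.sqrt (n%:R * phat X).

Let eta_gt0 : 0 < eta. Proof. by case/andP: eta01. Qed.
Let eta_lt1 : eta < 1. Proof. by case/andP: eta01. Qed.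

Let phat_bounds : (1 - eta / 16) * p <= phat X <= (1 + eta / 16) * p.
Proof. by move: phat_close; rewrite ler_norml => /andP[? ?]; apply/andP; split; lra. Qed.

Let phat_gt0 : p / 2 < phat X.
Proof.
have /andP[ph _] := phat_bounds; apply: lt_le_trans ph.
by rewrite mulrC ltr_pM2r //; have := eta_lt1; lra.
Qed.

Let t2 : t ^+ 2 = (2 + eta) ^+ 2 * (n%:R * phat X).
Proof.
by rewrite exprMn sqr_sqrtr // mulr_ge0 // ltW // (lt_trans _ phat_gt0) ?divr_gt0.
Qed.

(** The tolerance [eta / 16] for [phat] is small enough to leave a gap [eta / 4 * sigma] between the
    random threshold and the noise level [(2 + eta / 2) * sigma]. *)
Let t_ge : (2 + 3 / 4 * eta) * sigma <= t.
Proof.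
have e0 := ltW eta_gt0.
rewrite -(@ler_pXn2r _ 2) ?nnegrE ?mulr_ge0 ?sqrtr_ge0 ?addr_ge0 //; try lra.
rewrite t2 exprMn sigma2 mulrCA [leRHS]mulrCA ler_wpM2l //.
have /andP[ph _] := phat_bounds.
apply: le_trans (_ : (2 + eta) ^+ 2 * ((1 - eta / 16) * p) <= _).
  rewrite mulrA ler_wpM2r ?(ltW p_gt0) // -subr_ge0.
  have -> : (2 + eta) ^+ 2 * (1 - eta / 16) - (2 + 3 / 4 * eta) ^+ 2 =
    eta * (3 / 4 + 3 / 16 * eta - eta ^+ 2 / 16) by field.
  by rewrite mulr_ge0 //; have := eta_lt1; nra.
by rewrite ler_wpM2l ?sqr_ge0.
Qed.

Let t_le : t <= 5 * sigma.
Proof.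
have e0 := ltW eta_gt0; have s0 := ltW sigma_gt0.
rewrite -(@ler_pXn2r _ 2) ?nnegrE ?mulr_ge0 ?sqrtr_ge0 ?addr_ge0 //.
rewrite t2 exprMn sigma2 mulrCA [leRHS]mulrCA ler_wpM2l //.
have /andP[_ ph] := phat_bounds.
apply: le_trans (_ : (2 + eta) ^+ 2 * ((1 + eta / 16) * p) <= _).
  by rewrite ler_wpM2l ?sqr_ge0.
rewrite mulrA ler_wpM2r ?(ltW p_gt0) //; have := eta_lt1; nra.
Qed.

(** Dividing by [phat] instead of [p] adds an error [(phat X - p) *: M]. The 8 is 2 from squaring a
    sum times 4 from [phat X > p / 2]. *)
Let W_err (A : 'M[R]_n) : fnorm ((phat X)^-1 *: A - M) ^+ 2 <=
  8 / p ^+ 2 * fnorm (A - p *: M) ^+ 2 + 8 / p ^+ 2 * (phat X - p) ^+ 2 * n%:R ^+ 2.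
Proof.
have ph0 : 0 < phat X by apply: lt_trans phat_gt0; rewrite divr_gt0.
have -> : (phat X)^-1 *: A - M = (phat X)^-1 *: (A - p *: M - (phat X - p) *: M).
  by rewrite -addrA -opprD -scalerDl [p + _]addrC subrK scalerBr scalerA mulVf ?scale1r // gt_eqF.
rewrite fnormZ ?invr_ge0 ?(ltW ph0) // exprMn.
have d2 : fnorm ((phat X - p) *: M) ^+ 2 <= (phat X - p) ^+ 2 * n%:R ^+ 2.
  rewrite sqr_fnorm /dotmx linearZ /= -scalemxAl -scalemxAr !mxtraceZ mulrA -expr2.
  rewrite ler_wpM2l ?sqr_ge0 // -/(dotmx M M) -sqr_fnorm.
  by rewrite ler_pXn2r ?nnegrE ?fnorm_ge0.
have i2 : (phat X)^-1 ^+ 2 <= 4 / p ^+ 2.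
  rewrite exprVn -[leRHS]invrK lef_pV2 ?posrE ?invr_gt0 ?(divr_gt0 _ (exprn_gt0 2 p_gt0)) ?exprn_gt0 //.
  rewrite invf_div; apply: le_trans (_ : (p / 2) ^+ 2 <= _).
    by rewrite le_eqVlt; apply/orP; left; apply/eqP; field.
  by rewrite ler_pXn2r ?nnegrE ?(ltW phat_gt0) ?divr_ge0 // ltW.
set F := fnorm (A - p *: M).
apply: le_trans (_ : 4 / p ^+ 2 * (2 * F ^+ 2 + 2 * ((phat X - p) ^+ 2 * n%:R ^+ 2)) <= _);
  last by rewrite le_eqVlt; apply/orP; left; apply/eqP; field; apply: lt0r_neq0.
apply: ler_pM => //; rewrite ?exprn_ge0 ?invr_ge0 ?fnorm_ge0 ?(ltW ph0) //.
apply: le_trans (_ : (F + fnorm ((phat X - p) *: M)) ^+ 2 <= _).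
  by rewrite ler_pXn2r ?nnegrE ?addr_ge0 ?fnorm_ge0 ?fnormB.
have := sqr_ge0 (F - fnorm ((phat X - p) *: M)); rewrite sqrrB sqrrD; lra.
Qed.

(** Inserting [tau <= 3 * sigma], [t + tau <= 8 * sigma] and the gap into [threshold_error] gives
    176 = 144 + 32 and 290 = 288 + 2, where the second summands are enlarged by powers of [eta^-1];
    [W_err] multiplies both by 8. *)
Lemma usvt_loss :
  (n%:R ^+ 2)^-1 * (\sum_i \sum_j (Mhat i j - M i j) ^+ 2) <=
    1408 / eta * (rho / sigma) + 2320 / eta ^+ 2 * (eps ^+ 2 / n%:R ^+ 2)
    + 8 / p ^+ 2 * (phat X - p) ^+ 2.
Proof.
have [s [U [V [[UU VV s0 Ysvd] ->]]]] := usvtM.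
rewrite /thresholded -/t.
pose A := \sum_(i | t <= s i) s i *: (col i U *m (col i V)^T); rewrite -/A.
have loss_le : \sum_i \sum_j ((map_mx (@truncate R) ((phat X)^-1 *: A)) i j - M i j) ^+ 2
    <= fnorm ((phat X)^-1 *: A - M) ^+ 2.
  rewrite sqr_fnorm dotmxE; apply: ler_sum => i _; apply: ler_sum => j _.
  rewrite -expr2 mxE.
  have -> : ((phat X)^-1 *: A - M) i j = ((phat X)^-1 *: A) i j - M i j.
    by rewrite mxE [X in _ + X]mxE.
  exact: truncate_dist.
pose tau := (2 + eta / 2) * sigma.
have tau0 : 0 <= tau by rewrite mulr_ge0 ?(ltW sigma_gt0) // addr_ge0 ?divr_ge0 // ltW.
have gap : eta / 4 * sigma <= t - tau by have := t_ge; rewrite /tau; lra.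
have gap0 : 0 < eta / 4 * sigma by rewrite mulr_gt0 ?divr_gt0.
have tau_lt : tau < t by rewrite -subr_gt0; apply: lt_le_trans gap.
have B_norm : fnorm (p *: M) <= n%:R * p.
  by rewrite fnormZ ?(ltW p_gt0) // mulrC ler_wpM2r ?(ltW p_gt0).
have BQ_norm : fnorm (p *: M - Q *m (p *: M)) <= p * eps.
  by rewrite -scalemxAr -scalerBr fnormZ ?ler_wpM2l ?(ltW p_gt0).
have YE : zero_filled X = p *: M + (zero_filled X - p *: M) by rewrite addrC subrK.
have err := threshold_error YE UU VV s0 Ysvd tau0 tau_lt Z_op B_norm Q_sym Q_norm BQ_norm.
rewrite -/A in err.
have err2 : fnorm (A - p *: M) ^+ 2 <=
   (176 / eta) * (rho * sigma * (n%:R * p)) + 290 / eta ^+ 2 * (p * eps) ^+ 2.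
  apply: le_trans err _; set e := (p * eps) ^+ 2; set beta := n%:R * p.
  have e0 : 0 <= e by apply: sqr_ge0.
  have beta0 : 0 <= beta by rewrite mulr_ge0 ?(ltW p_gt0).
  have s0' := ltW sigma_gt0.
  have d0 : 0 < t - tau by rewrite subr_gt0.
  have inv_d : (t - tau)^-1 <= 4 / (eta * sigma).
    rewrite -[leRHS]invrK lef_pV2 ?posrE ?invr_gt0 ?divr_gt0 ?mulr_gt0 //.
    by rewrite invf_div; apply: le_trans gap; rewrite mulrAC.
  have br0 : 0 <= beta * rho by apply: mulr_ge0.
  apply: le_trans (_ : 2 * (3 * sigma) ^+ 2 *
      (2 * beta * rho * (4 / (eta * sigma)) + e * (4 / (eta * sigma)) ^+ 2)
      + 2 * (2 * rho * (8 * sigma) * beta + e) <= _).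
    apply: lerD.
      apply: ler_pM.
      - by rewrite mulr_ge0 ?sqr_ge0.
      - rewrite addr_ge0 // divr_ge0 ?sqr_ge0 ?(ltW d0) //.
        by rewrite -mulrA mulr_ge0.
      - rewrite ler_wpM2l // lerXn2r ?nnegrE // ?mulr_ge0 //.
        by rewrite ler_wpM2r //; have := eta_lt1; lra.
      apply: lerD; first by rewrite ler_wpM2l // -mulrA mulr_ge0.
      rewrite ler_wpM2l // -exprVn ler_pXn2r ?nnegrE ?invr_ge0 ?(ltW d0) //.
      by rewrite divr_ge0 ?mulr_ge0 ?(ltW eta_gt0).
    rewrite ler_wpM2l // lerD2r ler_wpM2r // ler_wpM2l ?mulr_ge0 //.
    have := t_le; have := eta_lt1; rewrite /tau => h1 h2.
    have : (2 + eta / 2) * sigma <= 3 * sigma by rewrite ler_wpM2r //; lra.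
    lra.
  have eV : 1 <= eta^-1 by rewrite invf_ge1 ?(ltW eta_lt1).
  have eV2 : 1 <= eta^-1 ^+ 2 by rewrite exprn_ege1.
  have -> : 2 * (3 * sigma) ^+ 2 *
      (2 * beta * rho * (4 / (eta * sigma)) + e * (4 / (eta * sigma)) ^+ 2)
      + 2 * (2 * rho * (8 * sigma) * beta + e) =
      144 / eta * (rho * sigma * beta) + 288 / eta ^+ 2 * e + 1 * (32 * (rho * sigma * beta))
      + 1 * (2 * e).
    by field; apply/andP; split; apply: lt0r_neq0.
  apply: le_trans (_ : 144 / eta * (rho * sigma * beta) + 288 / eta ^+ 2 * e
     + eta^-1 * (32 * (rho * sigma * beta)) + eta^-1 ^+ 2 * (2 * e) <= _).
    have x0 : 0 <= rho * sigma * beta by rewrite mulr_ge0 // mulr_ge0.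
    by apply: lerD; [apply: lerD => // |]; rewrite ler_wpM2r // mulr_ge0.
  by rewrite le_eqVlt; apply/orP; left; apply/eqP; field; apply: lt0r_neq0.
have n2 : (0 : R) < n%:R ^+ 2 by rewrite exprn_gt0.
rewrite mulrC ler_pdivrMr //; apply: le_trans loss_le _.
apply: le_trans (W_err A) _.
apply: le_trans (_ : 8 / p ^+ 2 * (176 / eta * (rho * sigma * (n%:R * p))
   + 290 / eta ^+ 2 * (p * eps) ^+ 2) + 8 / p ^+ 2 * (phat X - p) ^+ 2 * n%:R ^+ 2 <= _).
  by rewrite lerD2r ler_wpM2l // divr_ge0 ?sqr_ge0.
(* Turns [rho * sigma / (n%:R * p)] into [rho / sigma]. *)
have sE : sigma = n%:R * p / sigma.
  by rewrite -sigma2 expr2 mulfK // lt0r_neq0.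
rewrite le_eqVlt; apply/orP; left; apply/eqP; rewrite {1}sE.
by field; rewrite !lt0r_neq0.
Qed.

End Pointwise.

Local Open Scope classical_set_scope.
Local Open Scope ring_scope.

(** * From events on the sample space to finite sums *)

Section FiniteIndependence.
Variables (R : realType) (d : measure_display) (T : measurableType d).
Variables (P : probability T R) (X : finType) (A : X -> set T) (pr : X -> R).
Hypothesis mA : forall x, measurable (A x).
Hypothesis indepA : forall D : {set X},
  P (\big[setI/setT]_(x in D) A x) = (\prod_(x in D) pr x)%:E.

(** One complement is removed at a time: the probability of [C] minus [A x] is that of [C] less that
    of [C] intersected with [A x], and the induction hypothesis gives both. *)
Lemma indep_compl (m : nat) : forall N D : {set X}, #|N| = m ->
  disjoint (mem D) (mem N) ->
  P ((\big[setI/setT]_(x in D) A x) `&` \big[setI/setT]_(x in N) ~` A x) =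
  (\prod_(x in D) pr x * \prod_(x in N) (1 - pr x))%:E.
Proof.
elim: m => [|m IH] N D cN DN.
  by move/eqP: cN; rewrite cards_eq0 => /eqP ->; rewrite !big_set0 setIT mulr1.
have [x xN] : exists x, x \in N by apply/card_gt0P; rewrite cN.
have xD : x \notin D by rewrite (disjointFl DN).
have cN' : #|(N :\ x)%SET| = m by have := cardsD1 x N; rewrite xN cN => -[].
have DN' : disjoint (mem D) (mem (N :\ x)%SET).
  by apply: disjointWr DN; apply: subD1set.
have xDN' : disjoint (mem (x |: D)%SET) (mem (N :\ x)%SET).
  apply/pred0P => y; rewrite /= !inE; case: eqP => //= _.
  by have /pred0P/(_ y) := DN.
rewrite (big_setD1 x xN) [in RHS](big_setD1 x xN) /=.
set C := _ `&` _.
have -> : C = ((\big[setI/setT]_(y in D) A y) `&`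
      \big[setI/setT]_(y in (N :\ x)%SET) ~` A y) `\` A x.
  by rewrite /C setDE [~` A x `&` _]setIC setIA.
have mC : measurable ((\big[setI/setT]_(y in D) A y) `&`
      \big[setI/setT]_(y in (N :\ x)%SET) ~` A y).
  apply: measurableI; apply: bigsetI_measurable => y _ //.
  exact: measurableC.
rewrite measureD // ?(le_lt_trans (probability_le1 P mC)) ?ltry //.
have -> : (\big[setI/setT]_(y in D) A y) `&` (\big[setI/setT]_(y in (N :\ x)%SET) ~` A y)
    `&` A x = (\big[setI/setT]_(y in (x |: D)%SET) A y)
    `&` \big[setI/setT]_(y in (N :\ x)%SET) ~` A y.
  by rewrite big_setU1 //= setIAC (setIC _ (A x)).
apply: etrans (congr2 (fun a b => (a - b)%E) (IH _ _ cN' DN') (IH _ _ cN' xDN')) _.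
rewrite big_setU1 //= -EFinB; congr EFin; ring.
Qed.

Lemma indep_cell (c : X -> bool) :
  P (\big[setI/setT]_x (if c x then A x else ~` A x)) =
  (\prod_x (if c x then pr x else 1 - pr x))%:E.
Proof.
have DN : disjoint (mem [set x | c x]%SET) (mem [set x | ~~ c x]%SET).
  by apply/pred0P => x; rewrite /= !inE andbN.
have := indep_compl erefl DN.
rewrite !(big_mkcond (fun x => x \in _)) -!big_split /= => E1.
rewrite (eq_bigr (fun x => (if x \in [set x | c x]%SET then A x else setT) `&`
  (if x \in [set x | ~~ c x]%SET then ~` A x else setT))) ?{}E1.
  congr EFin; apply: eq_bigr => x _; rewrite !inE.
  by case: (c x); rewrite ?mulr1 ?mul1r.
by move=> x _; rewrite !inE; case: (c x); rewrite /= ?setIT ?setTI.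
Qed.

End FiniteIndependence.

Section FiniteExpectation.
Variables (R : realType) (d : measure_display) (T : measurableType d).
Variables (P : probability T R).

(* The integral of a nonnegative function is a supremum over the simple
   functions below it, so no measurability of [f] is needed; the estimator is
   not assumed to be measurable. *)
Lemma le_expectation_nonmeasurable (f g : T -> R) :
  (forall w, 0 <= f w) -> (forall w, f w <= g w) ->
  ('E_P[f] <= 'E_P[g])%E.
Proof.
move=> f0 fg; rewrite !unlock.
rewrite !ge0_integralTE; first last.
- by move=> w; rewrite lee_fin.
- by move=> w; rewrite lee_fin (le_trans (f0 w)).
apply: ereal_sup_le => _ [h /= hf <-]; exists h => //= w.
by apply: le_trans (hf w) _; rewrite lee_fin.
Qed.

Lemma expectation_finite_valued (C : finType) (X : T -> C) (m : C -> R)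
    (g : C -> R) :
  (forall c, measurable (X @^-1` [set c])) ->
  (forall c, P (X @^-1` [set c]) = (m c)%:E) ->
  (forall c, 0 <= g c) ->
  ('E_P[fun w => g (X w)] = (\sum_c g c * m c)%R%:E)%E.
Proof.
move=> mX PX g0; rewrite unlock.
under eq_integral => w _.
  rewrite (_ : (g (X w))%:E =
    (\sum_c (g c)%:E * (\1_(X @^-1` [set c]) w)%:E)%E).
    over.
  rewrite (bigD1 (X w)) //= indicE mem_set // mule1 big1 ?adde0 // => c cX.
  rewrite indicE memNset ?mule0 // => /= Xc.
  by rewrite Xc eqxx in cX.
rewrite ge0_integral_sum //; last 2 first.
- move=> c; under eq_fun do rewrite -EFinM.
  apply/measurable_EFinP; apply: measurable_funM; first exact: measurable_cst.
  exact: measurable_indic.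
- by move=> c w _; rewrite mule_ge0 ?lee_fin.
rewrite -sumEFin; apply: eq_bigr => c _.
rewrite ge0_integralZl_EFin //; last by apply/measurable_EFinP; exact: measurable_indic.
rewrite integral_indic // setIT EFinM; congr (_ * _)%E; exact: PX.
Qed.

End FiniteExpectation.

(** * The tournament as a finite product space *)

Section TournamentLaw.
Variables (R : realType) (n : nat) (q : 'I_n -> 'I_n -> R) (p : R).
Variable E : tournament q p.

Definition max_games : nat := (\max_(e : 'I_n * 'I_n) ngames E e.1 e.2)%N.
Local Notation K := max_games.
Local Notation cell := (('I_n * 'I_n) * option 'I_K)%type.

Lemma ngames_le i j : (ngames E i j <= K)%N.
Proof. exact: (leq_bigmax (i, j)). Qed.

(* Cells outside [base_sources] carry the empty event, so that all cells are
   independent and the configurations form a full product space. *)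
Definition cell_event (x : cell) : set (sample_space E) :=
  match x.2 with
  | None => if (x.1.1 <= x.1.2)%N then observed E x.1.1 x.1.2 else set0
  | Some k => if (x.1.1 < x.1.2)%N && (k < ngames E x.1.1 x.1.2)%N
              then won E x.1.1 x.1.2 k else set0
  end.

Definition cell_base (x : cell) : bool :=
  match x.2 with
  | None => (x.1.1 <= x.1.2)%N
  | Some k => (x.1.1 < x.1.2)%N && (k < ngames E x.1.1 x.1.2)%N
  end.

Definition cell_source (x : cell) : source n :=
  match x.2 with
  | None => inl x.1
  | Some k => inr (x.1, nat_of_ord k)
  end.

Local Notation prob_of := (fun x : cell => cell_prob q p (ngames E) x.1 x.2).

Lemma cell_source_inj : injective cell_source.
Proof.
move=> [e [k|]] [e' [k'|]] //=; rewrite /cell_source /=.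
  by case=> -> /ord_inj ->.
by case=> ->.
Qed.

Lemma cell_event_measurable x : measurable (cell_event x).
Proof.
case: x => [[i j] [k|]]; rewrite /cell_event /=; case: ifP => // h.
  case/andP: h => lt_ij kN; apply: measurable_won => //.
  by rewrite neq_ltn lt_ij.
exact: measurable_observed.
Qed.

Lemma cell_event_prob x : sample_prob E (cell_event x) = (prob_of x)%:E.
Proof.
case: x => [[i j] [k|]]; rewrite /cell_event /=; case: ifP => h; rewrite ?measure0 //.
  case/andP: h => lt_ij kN; apply: prob_won => //.
  by rewrite neq_ltn lt_ij.
exact: prob_observed.
Qed.

(** A cell without a source makes both sides 0; otherwise the cells inject into the sources, whose
    product rule applies. *)
Lemma cell_event_indep (D : {set cell}) :
  sample_prob E (\big[setI/setT]_(x in D) cell_event x) =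
  (\prod_(x in D) prob_of x)%:E.
Proof.
have [/forall_inP Dbase|] := boolP [forall x in D, cell_base x]; last first.
  rewrite negb_forall => /existsP[x]; rewrite negb_imply => /andP[xD nbx].
  rewrite (bigD1 x) //= [in RHS](bigD1 x) //=.
  have -> : cell_event x = set0.
    by move: nbx; rewrite /cell_event /cell_base; case: (x.2) => [k|] /negPf ->.
  rewrite set0I measure0 (_ : cell_prob _ _ _ _ _ = 0) ?mul0r //.
  by move: nbx; rewrite /cell_prob /cell_base; case: (x.2) => [k|] /negPf ->.
pose s := [seq cell_source x | x <- enum D].
pose F := seq_fset tt s.
have uniq_s : uniq s by rewrite map_inj_uniq ?enum_uniq //; apply: cell_source_inj.
have evE x : x \in D ->
    source_event (@observed _ _ _ _ E) (@won _ _ _ _ E) (cell_source x) =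
    cell_event x.
  move=> /Dbase; rewrite /cell_base /source_event /cell_source /cell_event.
  by case: x => [[i j] [k|]] /= ->.
have FD : [set` F] `<=` base_sources (ngames E).
  move=> e /=; rewrite seq_fsetE => /mapP[x]; rewrite mem_enum => /Dbase.
  by case: x => [[i j] [k|]] /= hb ->.
have := independent_sources FD.
rewrite (_ : [set` F] = [set` s]); last first.
  by apply/seteqP; split => e /=; rewrite seq_fsetE.
rewrite bigcap_seq (perm_big _ (seq_fset_perm tt s)) undup_id // !big_map !big_enum /=.
rewrite (eq_bigr cell_event) => [->|x xD]; last exact: evE.
rewrite -prodEFin; apply: eq_bigr => x xD.
by rewrite evE // cell_event_prob.
Qed.

Local Notation config := {ffun 'I_n * 'I_n -> {ffun option 'I_K -> bool}}.

Definition outcome (w : sample_space E) : config :=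
  [ffun e => [ffun o => w \in cell_event (e, o)]].

Definition config_wt (c : config) : R :=
  \prod_e block_wt q p (ngames E) e (c e).

Lemma outcome_preimage (c : config) : outcome @^-1` [set c] =
  \big[setI/setT]_(x : cell)
     (if c x.1 x.2 then cell_event x else ~` cell_event x).
Proof.
rewrite -bigcap_seq; apply/seteqP; split => [w /= <- x _|w /= wc].
  rewrite !ffunE -surjective_pairing.
  by case: ifPn => [|]; [rewrite inE|rewrite notin_setE].
apply/ffunP => e; apply/ffunP => o; rewrite !ffunE.
have := wc (e, o) (mem_index_enum _) => /=; case: (c e o) => h.
  by rewrite mem_set.
by apply/negbTE; rewrite notin_setE.
Qed.

Lemma outcome_measurable c : measurable (outcome @^-1` [set c]).
Proof.
rewrite outcome_preimage; apply: bigsetI_measurable => x _.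
have mx := cell_event_measurable x.
by case: (c _ _) => //; apply: measurableC.
Qed.

Lemma outcome_law c : sample_prob E (outcome @^-1` [set c]) = (config_wt c)%:E.
Proof.
rewrite outcome_preimage.
apply: etrans (indep_cell cell_event_measurable cell_event_indep _) _.
congr EFin; rewrite /config_wt /block_wt pair_big /=.
by apply: eq_bigr => x _; rewrite /cell_wt.
Qed.

Lemma le_MSE_expect (M : 'M[R]_n) (Mhat : sample_space E -> 'M[R]_n)
    (G : config -> R) :
  (forall w, (n%:R ^+ 2)^-1 * (\sum_i \sum_j (Mhat w i j - M i j) ^+ 2)
     <= G (outcome w)) ->
  (forall c, 0 <= G c) ->
  (MSE (sample_prob E) Mhat M <= (expect (block_wt q p (ngames E)) G)%:E)%E.
Proof.
move=> leG G0; rewrite /MSE.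
apply: le_trans (_ : ('E_(sample_prob E)[fun w => G (outcome w)] <= _)%E).
  apply: le_expectation_nonmeasurable => // w.
  rewrite mulr_ge0 ?invr_ge0 ?exprn_ge0 //.
  by apply: sumr_ge0 => i _; apply: sumr_ge0 => j _; apply: sqr_ge0.
by rewrite (expectation_finite_valued outcome_measurable outcome_law).
Qed.

Lemma outcome_observed w i j :
  (w \in observed E i j) = outcome w (upair i j) None.
Proof.
rewrite /upair; case: leqP => [le_ij|/ltnW le_ji].
  by rewrite !ffunE /cell_event /= le_ij.
by rewrite !ffunE /cell_event /= le_ji observed_sym.
Qed.

Lemma win_ratio_outcome w (i j : 'I_n) : (i < j)%N ->
  win_ratio R (ngames E) (i, j) (outcome w (i, j)) = win_proportion i j w.
Proof.
move=> lt_ij; rewrite /win_ratio /win_proportion /=; congr (_ / _).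
rewrite (big_ord_widen K (fun k => \1_(won E i j k) w)) ?ngames_le //.
apply: eq_bigr => k kN; rewrite !ffunE /cell_event /= lt_ij kN.
by rewrite indicE.
Qed.

Lemma win_proportionC w (i j : 'I_n) : i != j ->
  win_proportion (E := E) i j w = 1 - win_proportion j i w.
Proof.
move=> ij; rewrite /win_proportion (ngames_sym E j i).
have N0 : (ngames E i j)%:R != 0 :> R by rewrite pnatr_eq0 -lt0n ngames_gt0.
apply: (mulIf N0); rewrite divfK // mulrBl divfK // mul1r.
rewrite -[X in _ = X%:R - _]card_ord -sum1_card natr_sum -sumrB.
apply: eq_bigr => k _; rewrite (no_draw ij) // !indicE in_setC.
by case: (w \in _); rewrite ?subrr ?subr0.
Qed.

Lemma zero_filled_outcome w i j :
  zero_filled (data_matrix (E := E) w) i j =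
  entry R (ngames E) i j (outcome w (upair i j)).
Proof.
rewrite /zero_filled /data_matrix !mxE outcome_observed /entry.
case: (eqVneq i j) => [_|ij]; first by case: ifP.
case: (boolP (outcome w _ _)) => _; last by rewrite mul0r.
rewrite mul1r /= /upair; case: (ltngtP i j) => [lt_ij|lt_ji|/ord_inj eij].
- by rewrite win_ratio_outcome.
- by rewrite win_ratio_outcome // win_proportionC.
- by rewrite eij eqxx in ij.
Qed.

Lemma phat_outcome w :
  phat (data_matrix (E := E) w) = observed_rate R (outcome w).
Proof.
rewrite /phat /observed_rate; congr (_ / _).
rewrite -sum1_card natr_sum big_mkcond [RHS]big_mkcond /=.
apply: eq_bigr => e _; rewrite !inE !mxE outcome_observed.
rewrite /upair; case: (leqP e.1 e.2) => //= le_e.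
by rewrite -surjective_pairing; case: (outcome w e None).
Qed.

End TournamentLaw.

(** The exponent is even, so the trace is the squared Frobenius norm of a symmetric power. *)
Lemma trace_pow_ge0 (R : rcfType) (n : nat) (Z : 'M[R]_n) j :
  0 <= \tr ((Z *m Z^T) ^+ (2 ^ j.+1)).
Proof.
set S := Z *m Z^T.
have Ssym : S^T = S by rewrite /S trmx_mul trmxK.
have Xsym m : (S ^+ m)^T = S ^+ m.
  elim: m => [|m IH]; first by rewrite expr0 trmx1.
  by rewrite [in LHS]exprS trmx_mul IH Ssym exprSr.
rewrite expnS mul2n -addnn exprD -{2}(Xsym (2 ^ j)%N).
exact: dotmx_ge0.
Qed.

(** * Risk as a sum of bias, variance and tail terms *)

Section RiskBound.
Variables (R : realType) (n : nat) (q : 'I_n -> 'I_n -> R) (p eta : R).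
Variable E : tournament q p.
Variable Mhat : sample_space E -> 'M[R]_n.
Hypothesis n_gt0 : (0 < n)%N.
Hypothesis btm : nonparametric_bradley_terry q.
Hypothesis p01 : 0 < p <= 1.
Hypothesis eta01 : 0 < eta < 1.
Hypothesis usvtM : forall w, is_usvt eta (data_matrix w) (Mhat w).

Let q_win : win_probabilities q. Proof. by case: btm. Qed.
Let p_gt0 : 0 < p. Proof. by case/andP: p01. Qed.
Let p01' : 0 <= p <= 1. Proof. by case/andP: p01 => /ltW -> ->. Qed.
Let eta_gt0 : 0 < eta. Proof. by case/andP: eta01. Qed.
Let nR_gt0 : (0 : R) < n%:R. Proof. by rewrite ltr0n. Qed.
Let N := ngames E.
Let N_le := @ngames_le R n q p E.
Let N_gt0 := @ngames_gt0 R n q p E.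

Let sigma := Num.sqrt (n%:R * p).
Let sigma_gt0 : 0 < sigma. Proof. by rewrite sqrtr_gt0 mulr_gt0. Qed.
Let sigma2 : sigma ^+ 2 = n%:R * p.
Proof. by rewrite sqr_sqrtr // mulr_ge0 // ltW. Qed.

Let M : 'M[R]_n := mean_matrix q.

Let M01 i j : 0 <= M i j <= 1.
Proof.
rewrite mxE; case: eqP => [_|/eqP ij]; first by rewrite lexx ler01.
by have [] := q_win ij.
Qed.

Lemma MSE_le4 : (MSE (sample_prob E) Mhat M <= 4%:E)%E.
Proof.
have := @le_MSE_expect R n q p E M Mhat (fun=> 4).
rewrite (expect_cst (block_wt_sum1 _ q p N)); apply=> //.
by move=> w; apply: usvt_loss_le4 M01 (usvtM w).
Qed.

Let z i j (d : {ffun option 'I_(max_games E) -> bool}) : R := sigma^-1 * centred q p N i j d.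
Let Zn c : 'M[R]_n := noise_mx z c.

Lemma noise_outcome w :
  zero_filled (data_matrix (E := E) w) - p *: M = sigma *: Zn (outcome w).
Proof.
apply/matrixP => i j; rewrite mxE zero_filled_outcome [X in _ + X]mxE.
rewrite [X in _ - X]mxE [RHS]mxE [Zn _ i j]mxE /noise /z mulrA.
by rewrite mulfV ?lt0r_neq0 // mul1r /centred mxE.
Qed.

Let wt0 := @block_wt_ge0 R n (max_games E) q p N q_win p01'.
Let wt1 := @block_wt_sum1 R n (max_games E) q p N.

(** After division by [sigma] the entries are bounded by [sigma^-1] and have variance at most
    [p / sigma ^+ 2], which is 1/n. *)
Lemma noise_trace k :
  expect (block_wt q p N) (fun c => \tr ((Zn c *m (Zn c)^T) ^+ k)) <=
  n%:R * (2 + sigma^-1 * (k.*2.+1)%:R ^+ 2) ^+ k.*2.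
Proof.
have si0 : 0 <= sigma^-1 by rewrite invr_ge0 ltW.
have z_bound i j d : `|z i j d| <= sigma^-1.
  rewrite normrM ger0_norm // ler_piMr //.
  exact: (centred_bound N_le N_gt0 q_win p01').
have z_mean i j : \sum_d z i j d * block_wt q p N (upair i j) d = 0.
  rewrite /z; under eq_bigr do rewrite -mulrA.
  by rewrite -mulr_sumr (centred_mean p N_le N_gt0 q_win) mulr0.
have z_var i j : \sum_d z i j d ^+ 2 * block_wt q p N (upair i j) d <= n%:R^-1.
  rewrite /z; under eq_bigr do rewrite exprMn -mulrA.
  rewrite -mulr_sumr; apply: le_trans (_ : sigma^-1 ^+ 2 * p <= _).
    rewrite ler_wpM2l ?exprn_ge0 //.
    exact: (centred_var N_le N_gt0 q_win p01').
  rewrite exprVn sigma2 le_eqVlt; apply/orP; left; apply/eqP.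
  by field; rewrite !lt0r_neq0.
apply: (trace_bound wt0 wt1 si0 _ z_bound z_mean z_var).
  by rewrite invr_ge0.
by rewrite mulVf // lt0r_neq0.
Qed.

(** Chebyshev and Markov in pointwise form: [G] adds to the bound of [usvt_loss] two penalties, each
    at least 4 where the corresponding condition fails, and 4 dominates every loss. *)
Lemma risk_bound (g j : nat) (k := (2 ^ j.+1)%N) : (0 < g)%N ->
  (MSE (sample_prob E) Mhat M <=
   (1408 / eta * (Num.sqrt (n %/ g).+1%:R / sigma)
    + 2320 / eta ^+ 2 * ((2 * n * g)%:R / n%:R ^+ 2)
    + (8 + 1024 / eta ^+ 2) / (n%:R * p)
    + 4 * n%:R * ((2 + sigma^-1 * (k.*2.+1)%:R ^+ 2) / (2 + eta / 2)) ^+ k.*2)%:E)%E.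
Proof.
move=> g0.
have [_ [st [st_irr st_tr st_tot] st_mono]] := btm.
have q01 i i' : i != i' -> 0 <= q i i' <= 1 by move=> /q_win [].
pose tau : R := 2 + eta / 2.
have tau0 : 0 < tau by rewrite addr_gt0 ?divr_gt0.
set a1 := 1408 / eta * _; set a2 := 2320 / eta ^+ 2 * _.
have a1_ge0 : 0 <= a1.
  by apply: mulr_ge0; apply: divr_ge0;
    rewrite ?ler0n ?sqrtr_ge0 ?(ltW eta_gt0) ?(ltW sigma_gt0).
have a2_ge0 : 0 <= a2.
  by apply: mulr_ge0; apply: divr_ge0; rewrite ?ler0n ?sqr_ge0.
(* The 8 is the coefficient in [usvt_loss]; 1024 = 4 * 16^2 makes the penalty exceed 4 once [phat]
   misses [p] by more than [eta / 16 * p]. *)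
pose b := (8 + 1024 / eta ^+ 2) / p ^+ 2.
have b_ge0 : 0 <= b.
  apply: divr_ge0; last exact: sqr_ge0.
  apply: addr_ge0; first exact: ler0n.
  by apply: divr_ge0; rewrite ?ler0n ?sqr_ge0.
pose d := 4 / (tau ^+ 2) ^+ k.
have d_ge0 : 0 <= d by rewrite divr_ge0 ?exprn_ge0 ?(ltW tau0).
pose Tr c := \tr ((Zn c *m (Zn c)^T) ^+ k).
have Tr_ge0 c : 0 <= Tr c by apply: trace_pow_ge0.
pose G c := a1 + a2 + b * (observed_rate R c - p) ^+ 2 + d * Tr c.
have G_ge c : a1 + a2 + b * (observed_rate R c - p) ^+ 2 <= G c.
  by rewrite lerDl; apply: mulr_ge0.
have base_ge0 (c : {ffun 'I_n * 'I_n -> {ffun option 'I_(max_games E) -> bool}}) :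
    0 <= a1 + a2 + b * (observed_rate R c - p) ^+ 2.
  exact: addr_ge0 (addr_ge0 a1_ge0 a2_ge0) (mulr_ge0 b_ge0 (sqr_ge0 _)).
have G0 c : 0 <= G c := le_trans (base_ge0 c) (G_ge c).
apply: le_trans (@le_MSE_expect R n q p E M Mhat G _ G0) _; last first.
  rewrite lee_fin /G expectD expectD expectZ expectZ (expect_cst wt1).
  apply: lerD.
    rewrite -!addrA !lerD2l; apply: le_trans (_ : b * (p / n%:R) <= _).
      by rewrite ler_wpM2l // (observed_rate_var _ q N p01').
    by rewrite le_eqVlt; apply/orP; left; apply/eqP; rewrite /b; field;
      rewrite !lt0r_neq0.
  apply: le_trans (ler_wpM2l d_ge0 (noise_trace k)) _.
  rewrite /d -exprM mul2n expr_div_n -/tau le_eqVlt; apply/orP; left; apply/eqP.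
  move: (_ ^+ _) (_ ^+ _) => x y; ring.
move=> w; set c := outcome w.
have rateE : phat (data_matrix w) = observed_rate R c by apply: phat_outcome.
have [far|close] := ltP (eta / 16 * p) `|observed_rate R c - p|.
  apply: le_trans (usvt_loss_le4 n_gt0 M01 (usvtM w)) _; apply: le_trans _ (G_ge c).
  apply: le_trans (_ : b * (observed_rate R c - p) ^+ 2 <= _); last first.
    by rewrite lerDr; exact: addr_ge0 a1_ge0 a2_ge0.
  have ep0 : 0 < eta / 16 * p by rewrite mulr_gt0 ?divr_gt0.
  have far2 : (eta / 16 * p) ^+ 2 <= (observed_rate R c - p) ^+ 2.
    rewrite -[leRHS]real_normK ?num_real // ler_pXn2r ?nnegrE ?(ltW ep0) //.
    exact: ltW.
  apply: le_trans _ (ler_wpM2l b_ge0 far2).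
  have -> : b * (eta / 16 * p) ^+ 2 = 4 + eta ^+ 2 / 32.
    by rewrite /b; field; rewrite !lt0r_neq0.
  by rewrite lerDl divr_ge0 ?sqr_ge0.
have [bad|good] := ltP ((tau ^+ 2) ^+ k) (Tr c).
  apply: le_trans (usvt_loss_le4 n_gt0 M01 (usvtM w)) _.
  apply: le_trans (_ : d * Tr c <= _); last first.
    by rewrite lerDr; exact: base_ge0.
  have tk : 0 < (tau ^+ 2) ^+ k by rewrite !exprn_gt0.
  apply: le_trans _ (ler_wpM2l d_ge0 (ltW bad)).
  by rewrite divfK // lt0r_neq0.
have Zop : opnorm_le (Zn c) tau by apply: opnorm_trace good; apply: ltW.
have Zop' : opnorm_le (zero_filled (data_matrix w) - p *: M) (tau * sigma).
  rewrite noise_outcome -/c => u; rewrite -scalemxAr.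
  have -> : fnorm (sigma *: (u *m Zn c)) = sigma * fnorm (u *m Zn c).
    apply/eqP; rewrite -(@eqrXn2 _ 2) ?mulr_ge0 ?fnorm_ge0 ?(ltW sigma_gt0) //.
    rewrite exprMn !sqr_fnorm /dotmx linearZ /= -scalemxAl -scalemxAr.
    by rewrite !mxtraceZ expr2 mulrA.
  by rewrite mulrC -mulrA [X in _ <= _ * X]mulrC mulrA ler_wpM2r ?(ltW sigma_gt0).
pose Q : 'M[R]_n := block_average R (rank_group st g).
have Qn : fnorm Q <= Num.sqrt (n %/ g).+1%:R.
  rewrite -(@ler_pXn2r _ 2) ?nnegrE ?fnorm_ge0 ?sqrtr_ge0 // [leRHS]sqr_sqrtr ?ler0n //.
  exact: (block_average_norm R (rank_group_lt st g)).
have MQn : fnorm (M - Q *m M) <= Num.sqrt (2 * n * g)%:R.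
  rewrite -(@ler_pXn2r _ 2) ?nnegrE ?fnorm_ge0 ?sqrtr_ge0 // [leRHS]sqr_sqrtr ?ler0n //.
  exact: (block_average_error q01 st_irr st_tr st_tot st_mono g0).
have close' : `|phat (data_matrix w) - p| <= eta / 16 * p by rewrite rateE.
have := usvt_loss n_gt0 eta01 p01 M01 (usvtM w) Zop' close'
  (block_average_sym R (rank_group st g)) Qn MQn.
rewrite -/sigma -/a1 sqr_sqrtr // -/a2 rateE => loss_le.
apply: le_trans loss_le _; apply: le_trans _ (G_ge c).
rewrite lerD2l ler_wpM2r ?sqr_ge0 // ler_wpM2r ?invr_ge0 ?sqr_ge0 //.
by rewrite lerDl; apply: divr_ge0; rewrite ?ler0n ?sqr_ge0.
Qed.

End RiskBound.

(** * Choice of the moment and of the constants *)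

Section Numerics.
Variables (R : realType) (eta : R).
Hypothesis eta01 : 0 < eta < 1.

Let eta_gt0 : 0 < eta. Proof. by case/andP: eta01. Qed.
Let eta_lt1 : eta < 1. Proof. by case/andP: eta01. Qed.

Definition tail_const : R := (4356 / eta) ^+ 5 / (eta / 9) ^+ 16.

Lemma bernoulli_le (h : R) u : 0 <= h -> u%:R * h <= (1 + h) ^+ u.
Proof.
move=> h0; suff : 1 + u%:R * h <= (1 + h) ^+ u.
  by apply: le_trans; rewrite lerDr.
elim: u => [|u IH]; first by rewrite mul0r addr0 expr0.
rewrite exprS; apply: le_trans (ler_wpM2l _ IH); last by rewrite addr_ge0.
rewrite -natr1; set m := u%:R; have m0 : 0 <= m by apply: ler0n.
have : 0 <= m * h * h by rewrite !mulr_ge0.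
by clearbody m; nra.
Qed.

Lemma pow_ratio_le (a h u : R) : 0 < a -> 0 < h -> 1 <= u ->
  (a * u ^+ 2) ^+ 5 * ((u * h) ^+ 16)^-1 <= a ^+ 5 / h ^+ 16.
Proof.
move=> a0 h0 u1; have u0 : 0 < u by apply: lt_le_trans u1.
have -> : (a * u ^+ 2) ^+ 5 * ((u * h) ^+ 16)^-1 =
    a ^+ 5 / h ^+ 16 * (u ^+ 6)^-1.
  by field; rewrite !lt0r_neq0.
rewrite ler_piMr ?divr_ge0 ?exprn_ge0 ?(ltW a0) ?(ltW h0) //.
by rewrite invf_le1 ?exprn_gt0 // exprn_ege1.
Qed.

(** Here [x] is n^(1/4), so [x ^+ 4] is the factor n of the trace bound. By Bernoulli the power is
    at most a constant times u^(-16), whereas x^5 is at most a constant times u^10. *)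
Lemma tail_choice (x : R) : 1 <= x -> 1156 / eta <= x ->
  exists j, forall sigma : R, x <= sigma ->
    let k := (2 ^ j.+1)%N in
    x ^+ 4 * ((2 + sigma^-1 * (k.*2.+1)%:R ^+ 2) / (2 + eta / 2)) ^+ k.*2
      <= tail_const / x.
Proof.
move=> x1 x_big; have x0 : 0 < x by apply: lt_le_trans x1.
pose bad i := ~~ (((16 * 2 ^ i).+1%:R : R) ^+ 2 <= eta * x / 4).
have ex_bad : exists i, bad i.
  exists (Num.truncn x).+1; rewrite /bad -ltNge.
  have := truncnS_gt x; set m := (Num.truncn x).+1 => xm.
  apply: (@lt_le_trans _ _ m%:R).
    apply: le_lt_trans xm; rewrite ler_pdivrMr //.
    have : eta * x <= 1 * x by rewrite ler_wpM2r ?(ltW x0) ?(ltW eta_lt1).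
    lra.
  rewrite -natrX ler_nat; apply: (@leq_trans (2 ^ m)); first exact: ltnW (ltn_expl _ _).
  by nia.
case: (ex_minnP ex_bad) => i0 bad_i0 min_i0.
(* 1156 = 4 * 17^2 is exactly what makes index 0 admissible. *)
have i0_gt0 : (0 < i0)%N.
  rewrite lt0n; apply: contraNneq (bad_i0) => ->; rewrite expn0 muln1.
  move: x_big; rewrite ler_pdivrMr // => ?; rewrite ler_pdivlMr //.
  by rewrite -natrX -natrM mulrC (le_trans _ (_ : 1156 <= _)) // ler_nat.
(* [k = 8 u] for the largest power of two [u] with
   [(16 u + 1)^2 <= eta x / 4]. *)
pose u := (2 ^ i0.-1)%N; have u0 : (0 < u)%N by rewrite expn_gt0.
have lo : ((16 * u).+1%:R : R) ^+ 2 <= eta * x / 4.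
  by apply: contraT => /min_i0; rewrite -{1}(prednK i0_gt0) ltnn.
(* Maximality of [u], with 32 u + 1 <= 33 u; this is the origin of 4356 = 4 * 33^2. *)
have hi : eta * x / 4 < ((33 * u)%:R : R) ^+ 2.
  move: bad_i0; rewrite /bad -ltNge => bad_i0; apply: lt_le_trans bad_i0 _.
  rewrite -{1}(prednK i0_gt0) expnS -/u ler_pXn2r ?nnegrE ?ler0n // ler_nat; lia.
exists i0.-1.+2 => sigma le_sigma.
have -> : (2 ^ (i0.-1.+2).+1 = 8 * u)%N by rewrite !expnS -/u; lia.
rewrite /=; have -> : ((8 * u).*2 = 16 * u)%N by lia.
pose h := eta / 9; have h0 : 0 < h by rewrite divr_gt0.
have sigma0 : 0 < sigma by apply: lt_le_trans le_sigma.
set base := _ / _.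
have base_ge0 : 0 <= base.
  apply: divr_ge0; last by have := eta_gt0; lra.
  by rewrite addr_ge0 // mulr_ge0 ?invr_ge0 ?(ltW sigma0) ?sqr_ge0.
(* The 9 in [h] serves here: (2 + eta/4)(1 + eta/9) <= 2 + eta/2 for eta <= 1. *)
have base_le : base <= (1 + h)^-1.
  rewrite /base ler_pdivrMr; last by have := eta_gt0; lra.
  rewrite [leRHS]mulrC ler_pdivlMr; last by lra.
  have : sigma^-1 * ((16 * u).+1%:R : R) ^+ 2 <= eta / 4.
    rewrite mulrC ler_pdivrMr //; apply: le_trans lo _.
    by rewrite -mulrA [x / 4]mulrC mulrA ler_wpM2l // divr_ge0 // ltW.
  set s := sigma^-1 * _ => hs; have : 0 <= s.
    by rewrite mulr_ge0 ?invr_ge0 ?(ltW sigma0) ?sqr_ge0.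
  by move=> s0; have := eta_gt0; have := eta_lt1; rewrite /h; nra.
have uR : (1 : R) <= u%:R by rewrite ler1n.
have uh0 : 0 < u%:R * h by rewrite mulr_gt0 // (lt_le_trans ltr01).
have h1 : 0 < 1 + h by rewrite addr_gt0.
have grow : (u%:R * h) ^+ 16 <= (1 + h) ^+ (16 * u).
  rewrite mulnC exprM ler_pXn2r ?nnegrE ?exprn_ge0 ?(ltW uh0) ?(ltW h1) //.
  exact: bernoulli_le (ltW h0).
have base_pow : base ^+ (16 * u) <= ((u%:R * h) ^+ 16)^-1.
  apply: le_trans (_ : (1 + h)^-1 ^+ (16 * u) <= _).
    by rewrite lerXn2r ?nnegrE ?invr_ge0 ?(ltW h1).
  by rewrite exprVn lef_pV2 ?posrE ?exprn_gt0.
pose a := 4356 / eta; have a0 : 0 < a.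
  by rewrite /a; apply: divr_gt0; rewrite ?ltr0n.
have x_le : x <= a * u%:R ^+ 2.
  rewrite /a mulrAC ler_pdivlMr // mulrC; move: (ltW hi).
  rewrite ler_pdivrMr // natrM exprMn => hi'; apply: le_trans hi' _.
  by rewrite le_eqVlt; apply/orP; left; apply/eqP; ring.
rewrite ler_pdivlMr // mulrAC -exprSr.
apply: le_trans (_ : (a * u%:R ^+ 2) ^+ 5 * ((u%:R * h) ^+ 16)^-1 <= _).
  apply: ler_pM; rewrite ?exprn_ge0 ?(ltW x0) //.
  by rewrite ler_pXn2r ?nnegrE ?(ltW x0) // mulr_ge0 ?(ltW a0) ?sqr_ge0.
exact: pow_ratio_le.
Qed.

(** The first four terms match the summands of [risk_bound]. The last pair covers [x < 1156 / eta]
    and [x * Num.sqrt p < 1], where the trivial bound 4 suffices. *)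
Definition usvt_const : R :=
  2816 / eta + 9280 / eta ^+ 2 + (8 + 1024 / eta ^+ 2) + 4 * tail_const
  + (4624 / eta + 4).

End Numerics.

Lemma block_size_choice (R : realType) (x : R) (n : nat) :
  1 <= x -> x ^+ 4 = n%:R ->
  exists g : nat, [/\ (0 < g)%N, (n %/ g).+1%:R <= 2 * x & g%:R <= 2 * x ^+ 3].
Proof.
move=> x1 x4; have x0 : 0 < x by apply: lt_le_trans x1.
have x3 : 1 <= x ^+ 3 by rewrite exprn_ege1.
exists (Num.truncn (x ^+ 3)).+1; split=> //; last first.
  rewrite -natr1; have := truncn_le (x ^+ 3); rewrite (le_trans ler01 x3).
  by move=> ?; lra.
have := truncnS_gt (x ^+ 3); set g := (Num.truncn _).+1 => g_gt.
have g0 : (0 : R) < g%:R by rewrite ltr0n.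
have : (n %/ g)%:R <= x.
  rewrite -(ler_pM2r g0) -natrM; apply: le_trans (_ : n%:R <= _).
    by rewrite ler_nat leq_divM.
  by rewrite -x4 exprS ler_wpM2l ?(ltW x0) ?(ltW g_gt).
by rewrite -[(n %/ g).+1%:R]natr1 => ?; lra.
Qed.

Lemma usvt_rate (R : realType) (eta : R) (n : nat) (q : 'I_n -> 'I_n -> R) (p : R)
    (E : tournament q p) (Mhat : sample_space E -> 'M[R]_n) (x : R) :
  0 < eta < 1 -> (0 < n)%N -> nonparametric_bradley_terry q -> 0 < p <= 1 ->
  (forall w, is_usvt eta (data_matrix w) (Mhat w)) ->
  1 <= x -> x ^+ 4 = n%:R ->
  (MSE (sample_prob E) Mhat (mean_matrix q)
     <= (usvt_const eta / (x * Num.sqrt p))%:E)%E.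
Proof.
move=> eta01 n0 btm p01 usvtM x1 x4.
have eta_gt0 : 0 < eta by case/andP: eta01.
have p_gt0 : 0 < p by case/andP: p01.
have x0 : 0 < x by apply: lt_le_trans x1.
set s := Num.sqrt p.
have s0 : 0 < s by rewrite sqrtr_gt0.
have s1 : s <= 1 by rewrite -sqrtr1 ler_wsqrtr //; case/andP: p01.
have xs0 : 0 < x * s by apply: mulr_gt0.
have xs_le : x * s <= x by rewrite ler_piMr // ltW.
have e2 : 0 < eta ^+ 2 by apply: exprn_gt0.
pose c1 := 2816 / eta; pose c2 := 9280 / eta ^+ 2.
pose c3 := 8 + 1024 / eta ^+ 2; pose c4 := 4 * tail_const eta.
pose c5 := 4624 / eta.
have c1_ge0 : 0 <= c1 by apply: divr_ge0; [exact: ler0n|exact: ltW].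
have c2_ge0 : 0 <= c2 by apply: divr_ge0; [exact: ler0n|exact: ltW].
have c3_ge0 : 0 <= c3.
  by apply: addr_ge0; [exact: ler0n|apply: divr_ge0; [exact: ler0n|exact: ltW]].
have c4_ge0 : 0 <= c4.
  apply: mulr_ge0; first exact: ler0n.
  by apply: divr_ge0; apply: exprn_ge0; apply: divr_ge0; rewrite ?ler0n ?(ltW eta_gt0).
have c5_ge0 : 0 <= c5 by apply: divr_ge0; [exact: ler0n|exact: ltW].
have constE : usvt_const eta = c1 + c2 + c3 + c4 + (c5 + 4) by [].
have trivial_case : x * s * 4 <= usvt_const eta ->
    (MSE (sample_prob E) Mhat (mean_matrix q) <= (usvt_const eta / (x * s))%:E)%E.
  move=> le_c; apply: le_trans (MSE_le4 n0 btm usvtM) _.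
  by rewrite lee_fin ler_pdivlMr // mulrC.
have [small|xs1] := ltP (x * s) 1.
  apply: trivial_case; rewrite constE; clearbody c1 c2 c3 c4 c5; lra.
have [x_small|x_big] := ltP x (1156 / eta).
  apply: trivial_case; rewrite constE.
  have : x * 4 <= c5.
    have -> : c5 = 1156 / eta * 4 by rewrite /c5; field; apply: lt0r_neq0.
    by rewrite ler_wpM2r ?(ltW x_small).
  clearbody c1 c2 c3 c4 c5; lra.
have sigmaE : Num.sqrt (n%:R * p) = x ^+ 2 * s.
  by rewrite -x4 (exprM x 2 2) sqrtrM ?sqr_ge0 // sqrtr_sqr ger0_norm ?sqr_ge0.
(* This is how p >= n^(-1/2) enters the moment bound: [sigma] is at least n^(1/4), uniformly in
   [p]. *)
have le_sigma : x <= x ^+ 2 * s by rewrite expr2 -mulrA ler_peMr // ltW.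
have [j tail_j] := tail_choice eta01 x1 x_big.
have [g [g0 r_le g_le]] := block_size_choice x1 x4.
apply: le_trans (risk_bound n0 btm p01 eta01 usvtM j g0) _.
rewrite lee_fin sigmaE constE.
have inv_xs : x^-1 <= (x * s)^-1 by rewrite lef_pV2 ?posrE.
have n0R : n%:R != 0 :> R by rewrite pnatr_eq0 -lt0n.
apply: le_trans (_ : (c1 + c2 + c3 + c4) / (x * s) <= _); last first.
  rewrite ler_wpM2r ?invr_ge0 ?(ltW xs0) // lerDl.
  by apply: addr_ge0; last exact: ler0n.
rewrite [leRHS]mulrDl [(c1 + c2 + c3) / _]mulrDl [(c1 + c2) / _]mulrDl.
apply: lerD; first apply: lerD; first apply: lerD.
- have -> : c1 / (x * s) = 1408 / eta * ((2 * x) / (x ^+ 2 * s)).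
    by rewrite /c1; field; rewrite !lt0r_neq0.
  apply: ler_wpM2l; first by apply: divr_ge0; rewrite ?ler0n ?(ltW eta_gt0).
  rewrite ler_wpM2r ?invr_ge0 ?(le_trans _ le_sigma) ?(ltW x0) //.
  (* The crude estimate of the square root of [r] by [r] already meets the target rate. *)
  apply: le_trans _ r_le; set r := _%:R.
  have r1 : 1 <= r by rewrite ler1n.
  have r0 : 0 <= r by apply: le_trans r1.
  have : Num.sqrt r <= Num.sqrt (r ^+ 2) by rewrite ler_wsqrtr // expr2 ler_peMr.
  by rewrite sqrtr_sqr ger0_norm.
- have -> : c2 / (x * s) = 2320 / eta ^+ 2 * (4 / (x * s)).
    by rewrite /c2; field; rewrite !lt0r_neq0.
  apply: ler_wpM2l; first by apply: divr_ge0; rewrite ?ler0n ?(ltW e2).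
  apply: le_trans (_ : 4 / x <= _); last by rewrite ler_wpM2l.
  have -> : 4 / x = 2 * (2 * x ^+ 3) / n%:R.
    by rewrite -x4; field; apply: lt0r_neq0.
  have -> : (2 * n * g)%:R / n%:R ^+ 2 = 2 * g%:R / n%:R :> R.
    by rewrite !natrM; field.
  by rewrite ler_wpM2r ?invr_ge0 ?ler0n // ler_wpM2l.
- apply: ler_wpM2l; first exact: c3_ge0.
  have np0 : 0 < n%:R * p by rewrite mulr_gt0 // ltr0n.
  rewrite lef_pV2 ?posrE //.
  have -> : n%:R * p = (x * s) * (x ^+ 2 * (x * s)).
    by rewrite -x4 -[p]sqr_sqrtr ?(ltW p_gt0) // -/s; ring.
  have x2 : 1 <= x ^+ 2 by rewrite exprn_ege1.
  rewrite ler_peMr ?(ltW xs0) //.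
  by apply: le_trans xs1 _; rewrite ler_peMl ?(ltW xs0).
- rewrite /c4 -[leLHS]mulrA -[leRHS]mulrA; apply: ler_wpM2l => //.
  apply: le_trans (_ : tail_const eta / x <= _).
    by rewrite -x4; apply: tail_j.
  apply: ler_wpM2l => //; apply: divr_ge0; apply: exprn_ge0; apply: divr_ge0;
    by rewrite ?ler0n ?(ltW eta_gt0).
Qed.

Lemma MSE_ge0 (R : realType) (d : measure_display) (T : measurableType d)
    (P : probability T R) (n : nat) (Mhat : T -> 'M[R]_n) (M : 'M[R]_n) :
  (0 <= MSE P Mhat M)%E.
Proof.
apply: expectation_ge0 => w; rewrite mulr_ge0 ?invr_ge0 ?exprn_ge0 //.
by apply: sumr_ge0 => i _; apply: sumr_ge0 => j _; apply: sqr_ge0.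
Qed.

Lemma cvg_const_div_sqrt (R : realType) (C : R) (a : nat -> R) :
  a n @[n --> \oo] --> +oo -> C / Num.sqrt (a n) @[n --> \oo] --> 0.
Proof.
move=> /cvgryPgt a_oo; apply/cvgrPdist_lt => e e0.
near=> n.
have : ((`|C| + 1) / e) ^+ 2 < a n by near: n; apply: a_oo.
set B := (`|C| + 1) / e => B2.
have B0 : 0 < B by rewrite divr_gt0 // ltr_wpDl.
have a0 : 0 < a n by apply: lt_trans B2; rewrite exprn_gt0.
have v_gt : B < Num.sqrt (a n).
  by move: B2; rewrite -ltr_sqrt // sqrtr_sqr gtr0_norm.
have v0 : 0 < Num.sqrt (a n) by apply: lt_trans v_gt.
rewrite sub0r normrN normrM normfV (gtr0_norm v0) ltr_pdivrMr // mulrC.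
by move: v_gt; rewrite /B ltr_pdivrMr //; apply: lt_trans; rewrite ltrDl.
Unshelve. all: by end_near.
Qed.

Unset Implicit Arguments.

Theorem theorem2p11 (R : realType) (eta : R) (heta : 0 < eta < 1) :
  (exists C : R,
    forall (n : nat) (q : 'I_n -> 'I_n -> R) (p : R) (E : tournament q p)
           (Mhat : sample_space E -> 'M[R]_n),
      (0 < n)%N ->
      nonparametric_bradley_terry q ->
      0 < p <= 1 ->
      (forall w, is_usvt eta (data_matrix w) (Mhat w)) ->
      (MSE (sample_prob E) Mhat (mean_matrix q)
         <= (C * n%:R `^ (- (1 / 4)) / Num.sqrt p)%:E)%E)
  /\
  (forall (q : forall n : nat, 'I_n -> 'I_n -> R) (p : nat -> R)
          (E : forall n : nat, tournament (q n) (p n))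
          (Mhat : forall n : nat, sample_space (E n) -> 'M[R]_n),
      (forall n, nonparametric_bradley_terry (q n)) ->
      (forall n, 0 < p n <= 1) ->
      (forall n w, is_usvt eta (data_matrix w) (Mhat n w)) ->
      p n * n%:R `^ (1 / 2) @[n --> \oo] --> +oo ->
      MSE (sample_prob (E n)) (Mhat n) (mean_matrix (q n)) @[n --> \oo] --> 0%E).
Proof.
have rate (n : nat) (q : 'I_n -> 'I_n -> R) (p : R) (E : tournament q p)
    (Mhat : sample_space E -> 'M[R]_n) : (0 < n)%N ->
    nonparametric_bradley_terry q -> 0 < p <= 1 ->
    (forall w, is_usvt eta (data_matrix w) (Mhat w)) ->
    (MSE (sample_prob E) Mhat (mean_matrix q)
      <= (usvt_const eta / (n%:R `^ (1 / 4) * Num.sqrt p))%:E)%E.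
  move=> n0 btm p01 usvtM; apply: usvt_rate => //.
    by rewrite -[X in X <= _](powRr0 n%:R) ler_powR ?ler1n.
  by rewrite -powR_mulrn ?powR_ge0 // -powRrM divfK // powRr1.
split.
  exists (usvt_const eta) => n q p E Mhat n0 btm p01 usvtM.
  apply: le_trans (rate n q p E Mhat n0 btm p01 usvtM) _.
  by rewrite powRN -mulrA -invfM.
move=> q p E Mhat btm p01 usvtM p_oo.
apply: (@squeeze_cvge _ _ _ _ (fun=> 0%E) _
  (fun n => (usvt_const eta / Num.sqrt (p n * n%:R `^ (1 / 2)))%:E)).
- near=> n; rewrite MSE_ge0 /=.
  (* The rate is stated for positive [n], so the squeeze holds only eventually. *)
  have n0 : (0 < n)%N by near: n; exact: nbhs_infty_gt.
  apply: le_trans (rate n _ _ _ _ n0 (btm n) (p01 n) (usvtM n)) _.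
  rewrite lee_fin le_eqVlt; apply/orP; left; apply/eqP; congr (_ / _).
  have /andP[/ltW pn0 _] := p01 n.
  rewrite sqrtrM // mulrC; congr (_ * _).
  have -> : n%:R `^ (1 / 2) = (n%:R `^ (1 / 4)) ^+ 2 :> R.
    by rewrite -powR_mulrn ?powR_ge0 // -powRrM; congr (_ `^ _); lra.
  by rewrite sqrtr_sqr ger0_norm // powR_ge0.
- exact: cvg_cst.
- by apply: cvg_EFin; [exact: nearW|apply: cvg_const_div_sqrt].
Unshelve. all: by end_near.
Qed.
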